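(* Let $S=\{(q,p)\in M : p=u(q)\}$ be an arbitrary $C^\infty$-small perturbation of the zero section $Z=\{p=0\}\subset M$ such that the $1$-form $u(q)\,dq=\sum_i u_i(q)\,dq_i$ on $\mathbb{T}^n$ is not closed (that is, the section $S$ is non-Lagrangian; this is only possible when $n\ge 2$). Given any $c>0$, there exists a Hamiltonian function $H\in\mathcal{H}$ such that $H(t,x)\ge c$ for every $t\in[0,1]$ and every $x\in S$ and such that every $1$-periodic solution of the Hamiltonian system $\dot q=\frac{\partial H}{\partial p}(t,q,p)$, $\dot p=-\frac{\partial H}{\partial q}(t,q,p)$ is contractible.
   Context: $M=U^*\mathbb{T}^n=\mathbb{T}^n\times\mathbb{D}^n$ is the open unit cotangent bundle of the $n$-dimensional Euclidean torus $\mathbb{T}^n=\mathbb{R}^n/\mathbb{Z}^n$, with canonical coordinates $(q,p)=(q_1,\dots,q_n,p_1,\dots,p_n)$, $q_i\equiv q_i+1$, and $\mathbb{D}^n=\{|p|<1\}\subset\mathbb{R}^n$ the open Euclidean unit ball. $\mathcal{H}$ is the space of all smooth compactly supported functions on $[0,1]\times M$. A $1$-periodic solution is a solution $x:[0,1]\to M$ with $x(1)=x(0)$; it is contractible if this closed loop is contractible in $M$. *)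

(* Defs.v *)
From HB Require Import structures.
From mathcomp Require Import all_boot all_order all_algebra.
From mathcomp Require Import all_classical all_reals all_analysis.

Set Implicit Arguments.
Unset Strict Implicit.
Unset Printing Implicit Defensive.

Import Order.TTheory GRing.Theory Num.Theory.
Import numFieldNormedType.Exports.

Local Open Scope classical_set_scope.
Local Open Scope quotient_scope.
Local Open Scope ring_scope.

Section Torus.
Variables (R : realType) (n : nat).

Definition lattice_rel : rel 'rV[R]_n :=
  fun a b => [forall i, (a 0 i - b 0 i) \is a Num.int].

Lemma lattice_rel_refl : reflexive lattice_rel.
Proof. by move=> a; apply/forallP => i; rewrite subrr rpred0. Qed.

Lemma lattice_rel_sym : symmetric lattice_rel.
Proof.
by move=> a b; apply/eq_forallb => i; rewrite -rpredN opprB.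
Qed.

Lemma lattice_rel_trans : transitive lattice_rel.
Proof.
move=> b a c /forallP ab /forallP bc; apply/forallP => i.
by rewrite -(subrK (b 0 i) (a 0 i)) -addrA rpredD.
Qed.

Definition lattice_eqv :=
  EquivRel lattice_rel lattice_rel_refl lattice_rel_sym lattice_rel_trans.

Definition torus := {eq_quot lattice_eqv}.

HB.instance Definition _ := Topological.copy torus (quotient_topology torus).
HB.instance Definition _ := Quotient.on torus.

Definition toT (q : 'rV[R]_n) : torus := \pi_torus q.

Lemma toT_eqP (a b : 'rV[R]_n) :
  toT a = toT b <-> forall i, (a 0 i - b 0 i) \is a Num.int.
Proof.
have h := @eqmodP _ lattice_eqv a b.
split=> [e|e]; first by apply/forallP/h; exact: e.
by apply/h/forallP.
Qed.

End Torus.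

Definition enorm (R : realType) (n : nat) (p : 'rV[R]_n) : R :=
  Num.sqrt (\sum_(i < n) p 0 i ^+ 2).

Definition unitCotangent (R : realType) (n : nat) :
    set (torus R n * 'rV[R]_n) :=
  [set x | enorm x.2 < 1].

Section Smooth.
Variables (R : realType) (V W : normedModType R).

Definition iterD (vs : seq V) (f : V -> W) : V -> W :=
  foldr (fun v g => 'D_v g) f vs.

(* In finite dimension a function is C^1 as soon as all its directional
   derivatives exist and are continuous, so this is C^oo on all of V. *)
Definition smooth (f : V -> W) : Prop :=
  forall vs : seq V, continuous (iterD vs f) /\
    forall (x v : V), derivable (iterD vs f) x v.

(* Smoothness on an arbitrary subset (here, one with boundary): local smooth
   extendability. Multiplying by a cutoff, the local extensions may be taken
   globally defined. *)
Definition smooth_on (A : set V) (f : V -> W) : Prop :=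
  forall a, A a -> exists2 F : V -> W, smooth F &
    \forall z \near a, A z -> F z = f z.

End Smooth.

Definition coordD (R : realType) (n : nat) (W : normedModType R) (i : 'I_n)
    (f : 'rV[R]_n -> W) : 'rV[R]_n -> W :=
  'D_(delta_mx 0 i : 'rV[R]_n) f.

Section Sections.
Variables (R : realType) (n : nat).

Definition smooth_torus (u : torus R n -> 'rV[R]_n) : Prop :=
  smooth (u \o @toT R n).

(* These sets, for k : nat and eps > 0, form a basis of neighbourhoods of the
   zero section in the C^oo topology. *)
Definition Csmall (k : nat) (eps : R) (u : torus R n -> 'rV[R]_n) : Prop :=
  forall s : seq 'I_n, (size s <= k)%N -> forall q : 'rV[R]_n,
    enorm (foldr (@coordD R n _) (u \o @toT R n) s q) < eps.

Definition closed_form (u : torus R n -> 'rV[R]_n) : Prop :=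
  forall (i j : 'I_n) (q : 'rV[R]_n),
    coordD i (fun q' => u (toT q') 0 j) q
    = coordD j (fun q' => u (toT q') 0 i) q.

Definition graph_section (u : torus R n -> 'rV[R]_n) :
    set (torus R n * 'rV[R]_n) :=
  [set x | unitCotangent x /\ x.2 = u x.1].

End Sections.

(* A time-dependent Hamiltonian is represented by a total function; only its
   values on [0,1] x M are ever used. Likewise a curve [0,1] -> M is a
   function on R of which only the restriction to [0,1] matters. *)
Section Hamiltonian.
Variables (R : realType) (n : nat).
Local Notation phase := (torus R n * 'rV[R]_n)%type.
Implicit Types (H : R -> phase -> R) (x : R -> phase).

Definition ham_domain : set (R * phase) := `[0, 1] `*` @unitCotangent R n.

Definition ham_lift H (z : R * ('rV[R]_n * 'rV[R]_n)) : R :=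
  H z.1 (toT z.2.1, z.2.2).

Definition ham_supp H : set (R * phase) :=
  closure [set z | ham_domain z /\ H z.1 z.2 != 0].

(* The closure is taken in R x T^n x R^n: the closure relative to [0,1] x M is
   compact iff this one is compact and contained in [0,1] x M. *)
Definition hamiltonian H : Prop :=
  [/\ smooth_on [set z | ham_domain (z.1, (toT z.2.1, z.2.2))] (ham_lift H),
      compact (ham_supp H) & ham_supp H `<=` ham_domain].

(* Two-sided on ]0, 1[, one-sided at the endpoints. *)
Definition has_deriv01 (f : R -> 'rV[R]_n) (t : R) (v : 'rV[R]_n) : Prop :=
  (fun s => (s - t)^-1 *: (f s - f t)) @ within `[0, 1] t^' --> v.

(* q is a local lift of the T^n-component of x, i.e. a choice of the
   coordinates q_i (defined modulo 1) along x near t. *)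
Definition ham_solution H x : Prop :=
  forall t : R, t \in `[0, 1] -> unitCotangent (x t) /\
    exists q : R -> 'rV[R]_n,
      [/\ \forall s \near t, s \in `[0, 1] -> (x s).1 = toT (q s),
          has_deriv01 q t
            (\row_i coordD i (fun p => H t (toT (q t), p)) (x t).2) &
          has_deriv01 (fun s => (x s).2) t
            (- \row_i coordD i (fun q' => H t (toT q', (x t).2)) (q t))].

End Hamiltonian.

(* Free null-homotopy of the closed loop x : [0,1] -> M inside M. *)
Definition contractible_loop (R : realType) (X : topologicalType) (M : set X)
    (x : R -> X) : Prop :=
  exists F : R * R -> X,
    [/\ {within `[0, 1] `*` `[0, 1], continuous F},
        forall s t : R, s \in `[0, 1] -> t \in `[0, 1] -> M (F (s, t)),
        forall t : R, t \in `[0, 1] -> F (0, t) = x t,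
        exists a, forall t : R, t \in `[0, 1] -> F (1, t) = a &
        forall s : R, s \in `[0, 1] -> F (s, 0) = F (s, 1)].

(* Main.v *)
Require Import Defs.
From HB Require Import structures.
From mathcomp Require Import all_boot all_order all_algebra.
From mathcomp Require Import all_classical all_reals all_analysis.
From mathcomp Require Import ring lra.
Import Order.TTheory GRing.Theory Num.Theory.
Import numFieldNormedType.Exports.

Set Implicit Arguments.
Unset Strict Implicit.
Unset Printing Implicit Defensive.

Local Open Scope classical_set_scope.
Local Open Scope ring_scope.

(**
Write r = p - u(q) for the fibre coordinate relative to the section, so that S
is the locus r = 0, and let {P, Q} be the Poisson bracket for which
dP/dt = {P, Q} along the solutions of Q.

The reason behind the theorem is that a section that is not Lagrangian can be
pushed off itself by an arbitrarily small Hamiltonian motion.  For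
F = A + g(q) + v(q) r_1 one finds on S
   {r_i, F} = - d_i g + v (d_i u_1 - d_1 u_i),
and this vector never vanishes for a suitable choice of g and v
([kick_transversality]).  The function g is a sum of functions of one angle
each, whose critical points all lie close to a point a at which
Om = d_2 u_1 - d_1 u_2 is nonzero; so dg vanishes only near a, and there the
choice v = N Om makes the second component at least N Om^2 - const > 0.

The Hamiltonian has two stages, H = alpha(t) F + beta(t) K, where F, cut off
away from S, acts during a short time tau, where K is a bump function equal to
1 on S and supported in a tube |r| < delta, and where alpha + beta >= c, with
an overlap of length sigma much shorter than tau.  Since F >= 1 and K = 1 on
S, we get H >= c there.  No flow is ever integrated: the argument bears on a
given closed solution x.
 - If x(1) lies in the tube, then x(0) = x(1) does, and so does x(tau + sigma)
   since K is conserved afterwards.  But the first stage moves some r_i by at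
   least c tau d / 2, which exceeds the width of the tube: a contradiction
   ([closed_orbit_off_tube]).
 - Otherwise K vanishes, with its differential, along x after time
   tau + sigma, so x rests from then on, while before that time the angles
   have hardly moved.  The loop lies over a small ball of the torus and can be
   contracted there ([loop_stays_close], [contractible_small]).
The constants are chosen in the order F, tau, delta, sigma: tau is small with
respect to F only, delta is small with respect to tau, and sigma is small with
respect to the size of the derivatives of K, which grows as delta shrinks.

All bounds come from the fact that a continuous function on T^n x R^n is
bounded over the closed unit ball ([qperiodic_bounded]).  Functions on the
torus are handled as functions of (q, p) in R^n x R^n that are periodic in q,
and a function x -> P(x) along a curve in T^n x R^n is differentiated through
local lifts of the curve ([evolution]).
*)

(** * Frechet smooth functions *)

Section FrechetSmooth.
Variable R : realType.
Implicit Types V W : normedModType R.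

(** Asking for Frechet differentiability of all iterated directional derivatives,
rather than for their continuity, gives chain rules at every order for free. *)
Definition fsmooth V (f : V -> R) : Prop :=
  forall (vs : seq V) (x : V), differentiable (Defs.iterD vs f) x.

Lemma fsmooth_diff V (f : V -> R) x : fsmooth f -> differentiable f x.
Proof. by move=> /(_ [::]). Qed.

Lemma fsmooth_derive V (f : V -> R) v : fsmooth f -> fsmooth ('D_v f).
Proof.
by move=> sf vs x; have := sf (rcons vs v) x; rewrite /Defs.iterD foldr_rcons.
Qed.

Lemma fsmooth_continuous V (f : V -> R) : fsmooth f -> continuous f.
Proof. by move=> sf x; exact: differentiable_continuous (fsmooth_diff _ sf). Qed.

Lemma fsmooth_smooth V (f : V -> R) : fsmooth f -> smooth f.
Proof.
move=> sf vs; split=> [x|x v].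
  exact: differentiable_continuous (sf vs x).
exact: diff_derivable (sf vs x).
Qed.

(** Smoothness by coinduction: it suffices to belong to a class of differentiable
functions that is stable under directional derivatives. *)
Lemma fsmooth_class V (A : (V -> R) -> Prop) :
  (forall f, A f -> (forall x, differentiable f x) /\ forall v, A ('D_v f)) ->
  forall f, A f -> fsmooth f.
Proof.
move=> AP f Af vs x.
have : A (Defs.iterD vs f) by elim: vs => //= v vs ih; exact: (AP _ ih).2.
by case/AP.
Qed.

Lemma derive_line (phi : R -> R) y s : differentiable phi y ->
  'D_s phi y = s * 'D_1 phi y.
Proof.
move=> dphi; rewrite !deriveE// -[in LHS](mulr1 s).
by rewrite -[s * 1]/(s *: (1 : R^o)) linearZ.
Qed.

Lemma derive_comp1 V (phi : R -> R) (f : V -> R) x v :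
  differentiable f x -> differentiable phi (f x) ->
  'D_v (phi \o f) x = 'D_1 phi (f x) * 'D_v f x.
Proof.
move=> df dphi.
rewrite deriveE; last exact: differentiable_comp.
by rewrite diff_comp//= -!deriveE// derive_line// mulrC.
Qed.

(** The derivatives of sums, products and compositions are again of this form,
which is what makes [fsmooth_class] applicable to all of them at once. *)
Inductive fsmooth_alg V : (V -> R) -> Prop :=
| fsmooth_alg_base f : fsmooth f -> fsmooth_alg f
| fsmooth_alg_add f g : fsmooth_alg f -> fsmooth_alg g -> fsmooth_alg (f + g)
| fsmooth_alg_mul f g : fsmooth_alg f -> fsmooth_alg g -> fsmooth_alg (f * g)
| fsmooth_alg_comp (phi : R -> R) f :
    fsmooth phi -> fsmooth_alg f -> fsmooth_alg (phi \o f).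

Lemma fsmooth_algP V (f : V -> R) : fsmooth_alg f -> fsmooth f.
Proof.
move: f; apply: fsmooth_class => f; elim=> {f}.
- move=> f sf; split=> [x|v]; first exact: fsmooth_diff.
  by apply: fsmooth_alg_base; exact: fsmooth_derive.
- move=> f g _ [df Df] _ [dg Dg]; split=> [x|v].
    exact: differentiableD.
  rewrite (_ : 'D_v _ = 'D_v f + 'D_v g); first exact: fsmooth_alg_add.
  by apply/funext => x; rewrite deriveD//; exact: diff_derivable.
- move=> f g af [df Df] ag [dg Dg]; split=> [x|v].
    exact: differentiableM.
  rewrite (_ : 'D_v _ = f * 'D_v g + g * 'D_v f); last first.
    by apply/funext => x; rewrite deriveM//; exact: diff_derivable.
  by apply: fsmooth_alg_add; exact: fsmooth_alg_mul.
- move=> phi f sphi af [df Df]; split=> [x|v].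
    by apply: differentiable_comp => //; exact: fsmooth_diff.
  rewrite (_ : 'D_v _ = ('D_1 phi \o f) * 'D_v f); last first.
    by apply/funext => x; rewrite derive_comp1//; exact: fsmooth_diff.
  apply: fsmooth_alg_mul => //; apply: fsmooth_alg_comp => //.
  exact: fsmooth_derive.
Qed.

Lemma fsmooth_cst V (c : R) : fsmooth (cst c : V -> R).
Proof.
apply: (@fsmooth_class _ (fun f => exists c, f = cst c)); last by exists c.
move=> _ [d ->]; split=> [x|v]; first exact: differentiable_cst.
by exists 0; apply/funext => x; rewrite derive_cst.
Qed.

Lemma fsmoothD V (f g : V -> R) : fsmooth f -> fsmooth g -> fsmooth (f + g).
Proof.
by move=> sf sg; apply/fsmooth_algP/fsmooth_alg_add; exact: fsmooth_alg_base.
Qed.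

Lemma fsmoothM V (f g : V -> R) : fsmooth f -> fsmooth g -> fsmooth (f * g).
Proof.
by move=> sf sg; apply/fsmooth_algP/fsmooth_alg_mul; exact: fsmooth_alg_base.
Qed.

Lemma fsmooth_comp V (phi : R -> R) (f : V -> R) :
  fsmooth phi -> fsmooth f -> fsmooth (phi \o f).
Proof.
by move=> sphi sf; apply/fsmooth_algP/fsmooth_alg_comp => //; exact: fsmooth_alg_base.
Qed.

Lemma fsmoothN V (f : V -> R) : fsmooth f -> fsmooth (- f).
Proof.
move=> sf; rewrite (_ : - f = cst (-1) * f); first exact/fsmoothM/sf/fsmooth_cst.
by apply/funext => x; rewrite [RHS]mulN1r.
Qed.

Lemma fsmoothB V (f g : V -> R) : fsmooth f -> fsmooth g -> fsmooth (f - g).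
Proof. by move=> sf sg; apply: fsmoothD => //; exact: fsmoothN. Qed.

Lemma fsmooth_sum V (I : finType) (f : I -> V -> R) :
  (forall i, fsmooth (f i)) -> fsmooth (fun x => \sum_i f i x).
Proof.
move=> sf; rewrite (_ : (fun x => _) = \sum_i f i); last first.
  by apply/funext => x; rewrite fct_sumE.
by elim/big_ind : _ => //; [exact: fsmooth_cst|exact: fsmoothD].
Qed.

Lemma fsmooth_linear V (f : {linear V -> R}) : continuous f -> fsmooth f.
Proof.
move=> cf vs x.
have : (exists c, Defs.iterD vs f = cst c) \/ (Defs.iterD vs f = f).
  elim: vs => [|v vs]; first by right.
  case=> [[c e]|e]; left.
    exists 0; apply/funext => y; rewrite /= -/(Defs.iterD _ _) e.
    by rewrite derive_cst.
  exists (f v); apply/funext => y; rewrite /= -/(Defs.iterD _ _) e deriveE.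
    by rewrite diff_lin.
  exact: linear_differentiable.
case=> [[c ->]|->]; first exact: differentiable_cst.
exact: linear_differentiable.
Qed.

Lemma fsmooth_pullback V W (L : {linear V -> W}) (f : W -> R) :
  continuous L -> fsmooth f -> fsmooth (f \o L).
Proof.
move=> cL.
move=> sf; apply: (@fsmooth_class _
  (fun g => exists2 h : W -> R, fsmooth h & g = h \o L)); last by exists f.
move=> _ [h sh ->]; split=> [x|v].
  apply: differentiable_comp; first exact: linear_differentiable.
  exact: fsmooth_diff.
exists ('D_(L v) h); first exact: fsmooth_derive.
have dL x : differentiable L x by exact: linear_differentiable.
apply/funext => x; rewrite /= deriveE; last first.
  by apply: differentiable_comp => //; exact: fsmooth_diff.
rewrite diff_comp//; last exact: fsmooth_diff.
by rewrite /= diff_lin// deriveE//; exact: fsmooth_diff.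
Qed.

End FrechetSmooth.

(** * Smooth functions of one real variable *)

Section OneVariable.
Variable R : realType.

(** In dimension one, 'D_v is v times the ordinary derivative, so a class stable
under scaling needs only the latter. *)
Lemma fsmooth_class1 (A : (R -> R) -> Prop) :
  (forall f c, A f -> A (fun x => c * f x)) ->
  (forall f, A f -> exists2 g, A g & forall x : R, is_derive x 1 f (g x)) ->
  forall f, A f -> fsmooth f.
Proof.
move=> AZ AP; apply: fsmooth_class => f /AP[g Ag fg].
have df x : differentiable f x.
  by apply/derivable1_diffP; case: (fg x).
split=> // v; rewrite (_ : 'D_v f = fun x => v * g x); first exact: AZ.
by apply/funext => x; rewrite derive_line//; case: (fg x) => _ ->.
Qed.

Lemma fsmooth_expR : fsmooth (@expR R).
Proof.
apply: (@fsmooth_class1 (fun f => exists a, f = fun x => a * expR x)).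
- by move=> _ c [a ->]; exists (c * a); apply/funext => x; rewrite mulrA.
- move=> _ [a ->]; exists (fun x => a * expR x); first by exists a.
  by move=> x; apply: is_deriveZ.
- by exists 1; apply/funext => x; rewrite mul1r.
Qed.

Lemma fsmooth_trig (a b : R) : fsmooth (fun x => a * sin x + b * cos x).
Proof.
apply: (@fsmooth_class1 (fun f => exists a b, f = fun x => a * sin x + b * cos x));
  last by exists a, b.
- move=> _ c [a' [b' ->]]; exists (c * a'), (c * b').
  by apply/funext => x; rewrite mulrDr !mulrA.
- move=> _ [a' [b' ->]]; exists (fun x => (- b') * sin x + a' * cos x).
    by exists (- b'), a'.
  move=> x; apply: (is_derive_eq (is_deriveD (is_deriveZ _ _) (is_deriveZ _ _))).
  by rewrite /GRing.scale/=; ring.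
Qed.

Lemma fsmooth_sin : fsmooth (@sin R).
Proof.
rewrite (_ : sin = fun x => 1 * sin x + 0 * cos x); first exact: fsmooth_trig.
by apply/funext => x; rewrite mul1r mul0r addr0.
Qed.

Lemma fsmooth_cos : fsmooth (@cos R).
Proof.
rewrite (_ : cos = fun x => 0 * sin x + 1 * cos x); first exact: fsmooth_trig.
by apply/funext => x; rewrite mul1r mul0r add0r.
Qed.

(** For k = 0 this is the classical flat function exp(- 1 / x).  The factors
x^-k make the family stable, up to linear combinations, under derivation. *)
Definition flat (k : nat) (x : R) : R :=
  if 0 < x then x ^- k * expR (- x^-1) else 0.

(** From exp y >= (y / m)^m with m = k + 2 and y = 1 / x: a quadratic bound, which
yields both continuity and a zero derivative at the origin. *)
Lemma flat_le k x : 0 < x -> flat k x <= (k.+2%:R) ^+ k.+2 * x ^+ 2.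
Proof.
move=> x0; rewrite /flat x0 expRN.
have m0 : 0 < (k.+2%:R : R) by rewrite ltr0n.
have xm : (k.+2%:R * x)^-1 ^+ k.+2 <= expR x^-1.
  have -> : x^-1 = k.+2%:R * (k.+2%:R * x)^-1.
    by field; rewrite !gt_eqF//= addrC natr1 addrC natr1.
  rewrite expRM_natl lerXn2r ?nnegrE ?expR_ge0 ?invr_ge0 ?mulr_ge0 ?ltW//.
  by rewrite (lt_le_trans _ (expR_ge1Dx _))// ltrDr.
rewrite ler_pdivrMr ?expR_gt0//.
have -> : x ^- k = k.+2%:R ^+ k.+2 * x ^+ 2 * (k.+2%:R * x)^-1 ^+ k.+2.
  rewrite exprVn exprMn -[in x ^+ k.+2]addn2 exprD; field.
  by rewrite !expf_neq0 ?gt_eqF//= addrC natr1 addrC natr1.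
by rewrite ler_wpM2l// mulr_ge0// exprn_ge0// ltW.
Qed.

Lemma flat_ge0 k x : 0 <= flat k x.
Proof.
rewrite /flat; case: ifPn => // x0.
by rewrite mulr_ge0 ?expR_ge0// invr_ge0 exprn_ge0// ltW.
Qed.

Lemma is_derive_flat k (x : R) :
  is_derive x 1 (flat k) (flat k.+2 x - k%:R * flat k.+1 x).
Proof.
have [x0|x0|->] := ltgtP x 0.
- rewrite {2 3}/flat ltNge ltW//= mulr0 subr0.
  apply: (@near_eq_is_derive _ _ _ (cst 0)).
  near=> y; rewrite /flat ltNge ltW//=; near: y.
  exact: lt_nbhsl.
- apply: (@near_eq_is_derive _ _ _ (fun y : R => y ^- k * expR (- y^-1) : R)).
    near=> y; rewrite /flat ifT//; near: y; exact: lt_nbhsr.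
  rewrite /flat x0.
  have xn0 : x != 0 by rewrite gt_eqF.
  have dV : is_derive x 1 (fun y : R => y^-1) (- x ^- 2).
    apply: (is_derive_eq (is_deriveV _ _)) => //.
    by rewrite /GRing.scale/= mulr1.
  have dE : is_derive x 1 (fun y : R => expR (- y^-1)) (x ^- 2 * expR (- x^-1)).
    apply: (is_derive_eq (is_derive1_comp (f := expR) (g := fun y => - y^-1) _ _)).
    by rewrite /GRing.scale/= opprK mulrC.
  have dX : is_derive x 1 (fun y : R => y ^- k) (- k%:R * x ^- k.+1).
    have dXk : is_derive x 1 (fun y : R => y ^+ k) (k%:R * x ^+ k.-1).
      apply: DeriveDef; first exact: exprn_derivable.
      by rewrite exp_derive /GRing.scale/= mulr1.
    apply: (is_derive_eq (is_deriveV (f := fun y : R => y ^+ k) _ dXk)).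
      by rewrite expf_neq0.
    rewrite /GRing.scale/=; case: (k) => [|m]; first by rewrite !mul0r mulr0 oppr0 mul0r.
    rewrite /= !exprS expr0; field.
    by rewrite expf_neq0 xn0.
  apply: (is_derive_eq (is_deriveM _ _)).
  rewrite /GRing.scale/= !exprS expr0; field.
  by rewrite expf_neq0 xn0.
- rewrite {2 3}/flat ltxx mulr0 subr0.
  have lim0 : (fun h : R => h^-1 *: ((flat k \o shift 0) (h *: 1) - flat k 0))
     @ 0^' --> 0.
    apply/cvgr0Pnorm_le => e e0.
    pose C : R := k.+2%:R ^+ k.+2.
    have C0 : 0 < C by rewrite exprn_gt0.
    near=> h.
    have hn0 : h != 0 by near: h; exact: nbhs_dnbhs_neq.
    rewrite /= addr0 [h *: 1]mulr1 {2}/flat ltxx subr0.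
    have [h0|h0] := ltP 0 h; last by rewrite /flat ltNge h0/= scaler0 normr0 ltW.
    rewrite normrM gtr0_norm ?invr_gt0// ger0_norm ?flat_ge0//.
    rewrite ler_pdivrMl//; apply: (le_trans (flat_le _ h0)).
    rewrite -/C expr2 mulrA mulrC ler_pM2l// -ler_pdivlMl//.
    have : `|h| < C^-1 * e.
      by near: h; apply: dnbhs0_lt; rewrite mulr_gt0// invr_gt0.
    by rewrite gtr0_norm// => /ltW.
  apply: DeriveDef; last exact/cvg_lim.
  by apply/cvg_ex; exists 0.
Unshelve. all: by end_near. Qed.

Inductive flat_span : (R -> R) -> Prop :=
| flat_span_base k : flat_span (flat k)
| flat_span_add f g : flat_span f -> flat_span g -> flat_span (f \+ g)
| flat_span_scale c f : flat_span f -> flat_span (fun x => c * f x).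

Lemma fsmooth_flat k : fsmooth (flat k).
Proof.
apply: (@fsmooth_class1 flat_span); last exact: flat_span_base.
  by move=> f c; exact: flat_span_scale.
move=> f; elim=> {f} [m|f g _ [f' sf' ff'] _ [g' sg' gg']|c f _ [f' sf' ff']].
- exists (flat m.+2 \+ (fun x => (- m%:R) * flat m.+1 x)).
    by apply: flat_span_add; [|apply: flat_span_scale]; exact: flat_span_base.
  by move=> x; rewrite /= mulNr; exact: is_derive_flat.
- exists (f' \+ g'); first exact: flat_span_add.
  by move=> x; exact: is_deriveD.
- exists (fun x => c * f' x); first exact: flat_span_scale.
  by move=> x; exact: is_deriveZ.
Qed.

End OneVariable.

(** * Continuous partial derivatives give differentiability *)

Section C1.
Variable R : realType.

Lemma is_derive_line (V W : normedModType R) (f : V -> W) (y v : V) (s : R) :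
  derivable f (s *: v + y) v ->
  is_derive s 1 (fun s : R => f (s *: v + y)) ('D_v f (s *: v + y)).
Proof.
move=> df.
have E : (fun h : R => h^-1 *: (((fun s : R => f (s *: v + y)) \o shift s)
     (h *: (1 : R)) - f (s *: v + y))) =
   (fun h => h^-1 *: ((f \o shift (s *: v + y)) (h *: v) - f (s *: v + y))).
  apply/funext => h /=; rewrite [h *: 1]mulr1 scalerDl.
  by rewrite addrA.
by apply: DeriveDef; [rewrite /derivable E | rewrite /derive E].
Qed.

Lemma MVT_from0 (f df : R -> R) (b : R) :
  (forall s : R, is_derive s 1 f (df s)) ->
  exists2 c, `|c| <= `|b| & f b - f 0 = b * df c.
Proof.
move=> fdf.
have cf : continuous f.
  by move=> s; apply/differentiable_continuous/derivable1_diffP; case: (fdf s).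
have [b0|b0] := leP 0 b.
- have [c] := MVT_segment b0 (fun s _ => fdf s) (continuous_subspaceT cf).
  rewrite in_itv/= => /andP[c0 cb] E; exists c; first by rewrite !ger0_norm.
  by rewrite E subr0 mulrC.
- have [c] := MVT_segment (ltW b0) (fun s _ => fdf s) (continuous_subspaceT cf).
  rewrite in_itv/= => /andP[cb c0] E; exists c; first by rewrite !ler0_norm ?lerN2// ltW.
  by rewrite -opprB E sub0r mulrN opprK mulrC.
Qed.

(** The increment along h is split into n increments, each along one coordinate
axis, and the mean value theorem is applied to each of them; the intermediate
points stay within `|h| of x in the sup norm. *)
Lemma C1_differentiable n (f : 'rV[R]_n -> R) :
  (forall i x, derivable f x (delta_mx 0 i)) ->
  (forall i, continuous ('D_(delta_mx 0 i) f)) ->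
  forall x, differentiable f x.
Proof.
move=> df cf x.
pose L (h : 'rV[R]_n) : R := \sum_(i < n) h 0 i * 'D_(delta_mx 0 i) f x.
have Llin : linear L.
  move=> a u v; rewrite /L /GRing.scale/= mulr_sumr -big_split/=.
  by apply: eq_bigr => i _; rewrite !mxE; ring.
pose LM := GRing.isLinear.Build _ _ _ _ _ Llin.
pose LL : {linear 'rV[R]_n -> R} := HB.pack L LM.
have cL : continuous LL.
  move=> y; apply: differentiable_continuous.
  rewrite (_ : (LL : _ -> _) = \sum_(i < n)
      ((fun h : 'rV[R]_n => h 0 i) * cst ('D_(delta_mx 0 i) f x))); last first.
    by apply/funext => h; rewrite fct_sumE.
  apply: differentiable_sum => i; apply: differentiableM => //.
  exact: differentiable_coord.
have expand : f \o shift x = cst (f x) + LL +o_ 0 id.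
  apply/eqaddoP => _ /posnumP[e].
  pose e' := e%:num / n.+1%:R.
  have e'0 : 0 < e' by rewrite divr_gt0.
  have near_x (i : 'I_n) : \forall y \near x,
      `|'D_(delta_mx 0 i) f x - 'D_(delta_mx 0 i) f y| < e'.
    by have /cvgrPdist_lt := cf i x; exact.
  (* the partial derivatives are close to their values at x on a common ball *)
  have : \forall y \near x, forall i,
      `|'D_(delta_mx 0 i) f x - 'D_(delta_mx 0 i) f y| < e'.
    have := filter_forall _ near_x; exact.
  move=> /nbhs_normP[r /= r0 Hr].
  have n0 : \forall h \near nbhs (0 : 'rV[R]_n), `|h| < r.
    by have := @nbhs0_lt R 'rV[R]_n r r0; exact.
  near=> h.
  have hr : `|h| < r by near: h; exact: n0.
  rewrite !fctE /=.
  (* t k keeps the first k coordinates of h *)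
  pose t k : 'rV[R]_n := \row_(j < n) if (j < k)%N then h 0 j else 0.
  have t0 : t 0%N = 0 by apply/rowP => j; rewrite !mxE.
  have tn : t n = h by apply/rowP => j; rewrite !mxE ltn_ord.
  have tS (k : 'I_n) : t k.+1 = h 0 k *: delta_mx 0 k + t k.
    apply/rowP => j; rewrite !mxE/= ltnS leq_eqVlt.
    have [->|jk] := eqVneq j k; first by rewrite eqxx ltnn mulr1 addr0.
    have -> : (j == k :> nat) = false by apply/negbTE.
    by rewrite mulr0 add0r.
  have -> : f (h + x) - (f x + L h) =
      \sum_(k < n) (f (t k.+1 + x) - f (t k + x)
        - h 0 k * 'D_(delta_mx 0 k) f x).
    rewrite sumrB opprD addrA; congr (_ - _).
    rewrite -(big_mkord xpredT (fun k => f (t k.+1 + x) - f (t k + x))).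
    by rewrite telescope_sumr// tn t0 add0r.
  apply: le_trans (ler_norm_sum _ _ _) _.
  apply: (@le_trans _ _ (\sum_(k < n) (e' * `|h|))); last first.
    rewrite sumr_const card_ord -mulr_natl mulrA ler_wpM2r//.
    by rewrite /e' mulrCA ler_piMr// ler_pdivrMr// mul1r ler_nat.
  apply: ler_sum => k _.
  have [c cb] := @MVT_from0 (fun s : R => f (s *: delta_mx 0 k + (t k + x)))
    (fun s => 'D_(delta_mx 0 k) f (s *: delta_mx 0 k + (t k + x))) (h 0 k)
    (fun s => is_derive_line (df k _)).
  rewrite scale0r add0r addrA -tS => ->.
  rewrite -mulrBr normrM mulrC; apply: ler_pM => //.
    rewrite distrC ltW//; apply: Hr.
    rewrite /ball_/= addrA opprD addrCA subrr addr0 normrN.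
    apply: le_lt_trans hr; rewrite [leLHS]/Num.Def.normr/= mx_normrE.
    apply: bigmax_le => // -[i j] _; rewrite ord1 !mxE/=.
    have hle (m : 'I_n) : `|h 0 m| <= `|h|.
      rewrite [leRHS]/Num.Def.normr/= mx_normrE.
      exact: (le_bigmax _ (fun ij => `|h ij.1 ij.2|) (0, m)).
    have [->|jk] := eqVneq j k.
      by rewrite ltnn mulr1 addr0 (le_trans cb).
    by rewrite mulr0 add0r; case: ifP => _; rewrite ?normr0.
  rewrite [leRHS]/Num.Def.normr/= mx_normrE.
  exact: (le_bigmax _ (fun ij => `|h ij.1 ij.2|) (0, k)).
apply/diff_locallyP.
by rewrite (diff_unique cL expand).
Unshelve. all: by end_near. Qed.

Lemma smooth_fsmooth n (f : 'rV[R]_n -> R) : smooth f -> fsmooth f.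
Proof.
move=> sf vs; apply: C1_differentiable => [i x|i].
  by have [_] := sf vs; exact.
by have [+ _] := sf (delta_mx 0 i :: vs).
Qed.

Lemma smooth_coord (V : normedModType R) n (f : V -> 'rV[R]_n) (i : 'I_n) :
  smooth f -> smooth (fun x => f x 0 i).
Proof.
move=> sf vs.
have E us : Defs.iterD us (fun x => f x 0 i) = fun x => Defs.iterD us f x 0 i.
  elim: us => //= u us ih; apply/funext => x; rewrite ih.
  by rewrite derive_mx ?mxE//; have [_] := sf us; exact.
have [cf df] := sf vs; split=> [x|x v]; rewrite E.
  have cc : {for Defs.iterD vs f x, continuous (fun M : 'rV[R]_n => M 0 i)}.
    have := @coord_continuous R 1 n 0 i; exact.
  exact: (continuous_comp (cf x) cc).
by have /derivable_mxP := df x v; exact.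
Qed.

End C1.

(** * Curves on the unit interval *)

Section Paths.
Variable R : realType.
Implicit Types W : normedModType R.

(** Difference quotients restricted to [0, 1]: for row vectors this is
[has_deriv01], but products of charts and scalars are needed too. *)
Definition deriv01 W (f : R -> W) (t : R) (v : W) : Prop :=
  (fun s => (s - t)^-1 *: (f s - f t)) @ within `[0, 1] t^' --> v.

Lemma deriv01P W (f : R -> W) t v : deriv01 f t v <->
  forall e, 0 < e -> exists2 d, 0 < d & forall s, `|s - t| < d -> s != t ->
    s \in `[0, 1] -> `|v - (s - t)^-1 *: (f s - f t)| < e.
Proof.
split.
- move=> /cvgrPdist_lt h e /h; rewrite near_withinE => /nbhs_ballP[d /= d0 hd].
  exists d => // s sd st s01; apply: hd => //.
  by rewrite /ball/= distrC.
- move=> h; apply/cvgrPdist_lt => e /h[d d0 hd]; rewrite near_withinE.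
  apply/nbhs_ballP; exists d => //= s; rewrite /ball/= distrC => sd st s01.
  exact: hd.
Qed.

Lemma is_deriveP W (f : R -> W) (t : R) v : is_derive t 1 f v <->
  forall e, 0 < e -> exists2 d, 0 < d & forall s, `|s - t| < d -> s != t ->
    `|v - (s - t)^-1 *: (f s - f t)| < e.
Proof.
have E : is_derive t 1 f v <->
    (fun h : R => h^-1 *: ((f \o shift t) (h *: 1) - f t)) @ 0^' --> v.
  split; first by case=> d <-.
  move=> h; apply: DeriveDef; last exact/cvg_lim.
  by apply/cvg_ex; exists v.
rewrite E; split.
- move=> /cvgrPdist_lt h e /h /nbhs_ballP[d /= d0 hd].
  exists d => // s sd st; have := hd (s - t).
  rewrite /ball/= sub0r normrN subr_eq0 [(s - t) *: 1]mulr1 subrK.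
  by apply.
- move=> h; apply/cvgrPdist_lt => e /h[d d0 hd].
  apply/nbhs_ballP; exists d => //= s; rewrite /ball/= sub0r normrN => sd sn0.
  have := hd (s + t); rewrite addrK [s *: 1]mulr1; apply => //.
  by rewrite -subr_eq0 addrK.
Qed.

Lemma deriv01_interior W (f : R -> W) t v : t \in `]0, 1[ ->
  deriv01 f t v -> is_derive t 1 f v.
Proof.
rewrite in_itv/= => /andP[t0 t1] /deriv01P h; apply/is_deriveP => e /h[d d0 hd].
exists (Num.min d (Num.min t (1 - t))).
  by rewrite !lt_min d0 t0 subr_gt0.
move=> s; rewrite !lt_min => /and3P[sd + +] st.
rewrite !ltr_norml => /andP[s0 _] /andP[_ s1].
by apply: hd => //; rewrite in_itv/=; apply/andP; split; lra.
Qed.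

(** Extending f beyond [0, 1] by its tangent line at t turns the one-sided
derivatives at the endpoints into two-sided ones, so that the usual chain rule
and continuity of differentiable functions apply there. *)
Definition tangent_ext W (f : R -> W) t v s :=
  if s \in `[0, 1] then f s else f t + (s - t) *: v.

Lemma tangent_ext_derive W (f : R -> W) t v : deriv01 f t v ->
  is_derive t 1 (tangent_ext f t v) v /\ tangent_ext f t v t = f t.
Proof.
have Et : tangent_ext f t v t = f t.
  by rewrite /tangent_ext; case: ifP => // _; rewrite subrr scale0r addr0.
move=> /deriv01P fv; split; last exact: Et.
apply/is_deriveP => e e0; have [d d0 hd] := fv e e0.
exists d => // s sd st; rewrite Et /tangent_ext; case: ifPn => [s01|_]; first exact: hd.
by rewrite addrAC subrr add0r scalerK ?subr_eq0// subrr normr0.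
Qed.

Lemma deriv01_comp W (P : W -> R) (f : R -> W) t v : 
  differentiable P (f t) -> deriv01 f t v ->
  deriv01 (P \o f) t ('D_v P (f t)).
Proof.
move=> dP /tangent_ext_derive[fv Et].
have df : differentiable (tangent_ext f t v) t by apply/derivable1_diffP; case: fv.
have : is_derive t 1 (P \o tangent_ext f t v) ('D_v P (f t)).
  have dPf : differentiable (P \o tangent_ext f t v) t.
    by apply: differentiable_comp => //; rewrite Et.
  apply: DeriveDef; first exact/derivable1_diffP.
  rewrite deriveE// diff_comp ?Et//= deriveE//.
  by case: fv => _; rewrite deriveE// => ->.
move=> /is_deriveP h; apply/deriv01P => e /h[d d0 hd]; exists d => // s sd st s01.
by have := hd s sd st; rewrite /= Et /tangent_ext s01.
Qed.

Lemma deriv01_pair W1 W2 (f : R -> W1) (g : R -> W2) t v w :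
  deriv01 f t v -> deriv01 g t w -> deriv01 (fun s => (f s, g s)) t (v, w).
Proof. by move=> fv gw; exact: (cvg_pair fv gw). Qed.

Lemma deriv01_near W (f g : R -> W) t v : f t = g t ->
  (\forall s \near t, s \in `[0, 1] -> f s = g s) ->
  deriv01 f t v -> deriv01 g t v.
Proof.
move=> fgt /nbhs_ballP[r /= r0 fg] /deriv01P h; apply/deriv01P => e /h[d d0 hd].
exists (Num.min d r); first by rewrite lt_min d0.
move=> s; rewrite lt_min => /andP[sd sr] st s01; rewrite -fgt -fg//; first exact: hd.
by rewrite /ball/= distrC.
Qed.

Lemma deriv01_continuous W (f df : R -> W) :
  (forall t, t \in `[0, 1] -> deriv01 f t (df t)) ->
  {within `[0, 1], continuous f}.
Proof.
move=> h; apply/subspace_continuousP => t t01.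
have [fv Et] := tangent_ext_derive (h t t01).
have : {for t, continuous (tangent_ext f t (df t))}.
  by apply/differentiable_continuous/derivable1_diffP; case: fv.
rewrite /prop_for /continuous_at Et => c.
apply/cvgrPdist_lt => e e0; rewrite near_withinE.
move/cvgrPdist_lt : c => /(_ e e0); apply: filterS => s + s01.
by rewrite /tangent_ext ifT.
Qed.

Lemma deriv01_mean (f df : R -> R) (a b : R) : 0 <= a -> a <= b -> b <= 1 ->
  (forall t, t \in `[0, 1] -> deriv01 f t (df t)) ->
  exists2 c, c \in `[a, b] & f b - f a = df c * (b - a).
Proof.
move=> a0 ab b1 h; apply: MVT_segment => //.
  move=> x; rewrite in_itv/= => /andP[ax xb]; apply: deriv01_interior.
    by rewrite in_itv/=; apply/andP; split; lra.
  by apply: h; rewrite in_itv/=; apply/andP; split; lra.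
apply: continuous_subspaceW (deriv01_continuous h).
by move=> x /=; rewrite !in_itv/= => /andP[ax xb]; apply/andP; split; lra.
Qed.

End Paths.

(** * Poisson brackets and evolution along solutions *)

Section Phase.
Variables (R : realType) (n : nat).
Local Notation chart := ('rV[R]_n * 'rV[R]_n)%type.
Local Notation phase := (torus R n * 'rV[R]_n)%type.
Implicit Types (P Q F K : chart -> R) (z : chart) (x : R -> phase).

Definition partial_q (i : 'I_n) P : chart -> R := 'D_(delta_mx 0 i, 0) P.
Definition partial_p (i : 'I_n) P : chart -> R := 'D_(0, delta_mx 0 i) P.

(** The sign is such that {P, Q} is the derivative of P along the flow of Q. *)
Definition poisson P Q : chart -> R :=
  fun z => \sum_(k < n) (partial_q k P z * partial_p k Q z - partial_p k P z * partial_q k Q z).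

(** The functions on R^n x R^n that come from T^n x R^n. *)
Definition qperiodic P := forall q q' p, toT q = toT q' -> P (q, p) = P (q', p).

Definition lift_pt (x : phase) : chart := (repr x.1, x.2).

Definition on_phase P (x : phase) : R := P (lift_pt x).

Lemma toT_repr (a : torus R n) : toT (repr a) = a.
Proof. by rewrite /toT reprK. Qed.

Lemma on_phase_toT P q p : qperiodic P -> on_phase P (toT q, p) = P (q, p).
Proof. by move=> pP; apply: pP; rewrite /= toT_repr. Qed.

Lemma fsmooth_poisson P Q : fsmooth P -> fsmooth Q -> fsmooth (poisson P Q).
Proof.
by move=> sP sQ; apply: fsmooth_sum => k; apply: fsmoothB; apply: fsmoothM;
   exact: fsmooth_derive.
Qed.

Lemma toTD (q q' h : 'rV[R]_n) : toT q = toT q' -> toT (h + q) = toT (h + q').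
Proof.
move=> /toT_eqP e; apply/toT_eqP => i; rewrite !mxE.
by rewrite opprD addrACA subrr add0r; exact: e.
Qed.

Lemma qperiodic_derive P v : qperiodic P -> qperiodic ('D_v P).
Proof.
move=> pP q q' p e; rewrite /derive.
rewrite (_ : (fun h => _) = (fun h : R => h^-1 *: ((P \o shift (q', p)) (h *: v)
  - P (q', p))))//.
apply/funext => h /=; congr (_ *: (_ - _)); last exact: pP e.
exact: (pP _ _ (h *: v.2 + p) (toTD (h *: v.1) e)).
Qed.

Lemma qperiodic_poisson P Q : qperiodic P -> qperiodic Q -> qperiodic (poisson P Q).
Proof.
move=> pP pQ q q' p e; apply: eq_bigr => k _.
by congr (_ * _ - _ * _); exact: qperiodic_derive e.
Qed.

Lemma derive_pair P z (u v : 'rV[R]_n) : differentiable P z ->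
  'D_(u, v) P z = \sum_(k < n) (u 0 k * partial_q k P z + v 0 k * partial_p k P z).
Proof.
move=> dP; rewrite deriveE//.
have -> : (u, v) = \sum_(k < n) (u 0 k *: ((delta_mx 0 k, 0) : chart)
    + v 0 k *: ((0, delta_mx 0 k) : chart)).
  rewrite big_split/=; apply: injective_projections; rewrite /= !raddf_sum/=.
    rewrite [X in _ + X]big1 ?addr0 => [|k _]; last by rewrite scaler0.
    exact: row_sum_delta.
  rewrite [X in X + _]big1 ?add0r => [|k _]; last by rewrite scaler0.
  exact: row_sum_delta.
rewrite linear_sum; apply: eq_bigr => k _.
by rewrite linearD !linearZ/= /partial_q /partial_p !deriveE.
Qed.

Lemma derive_snd P q p v : 'D_v (fun p' => P (q, p')) p = 'D_(0, v) P (q, p).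
Proof.
rewrite /derive (_ : (fun h => _) = (fun h : R => h^-1 *:
  ((P \o shift (q, p)) (h *: ((0, v) : chart)) - P (q, p))))//.
apply/funext => h /=.
congr (_ *: (P _ - _)); apply: injective_projections => //=.
by rewrite scaler0 add0r.
Qed.

Lemma derive_fst P q p v : 'D_v (fun q' => P (q', p)) q = 'D_(v, 0) P (q, p).
Proof.
rewrite /derive (_ : (fun h => _) = (fun h : R => h^-1 *:
  ((P \o shift (q, p)) (h *: ((v, 0) : chart)) - P (q, p))))//.
apply/funext => h /=.
congr (_ *: (P _ - _)); apply: injective_projections => //=.
by rewrite scaler0 add0r.
Qed.

Lemma derive_lin2 F K (a b : R) z v : fsmooth F -> fsmooth K ->
  'D_v (fun z => a * F z + b * K z) z = a * 'D_v F z + b * 'D_v K z.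
Proof.
move=> sF sK.
have d Q : fsmooth Q -> derivable Q z v by move=> ?; apply/diff_derivable/fsmooth_diff.
have -> : (fun z => a * F z + b * K z) = a *: F + b *: K by [].
rewrite deriveD; [|exact/derivableZ/d..].
by rewrite (deriveZ _ (d _ sF)) (deriveZ _ (d _ sK)).
Qed.

Lemma poisson_lin2 P F K (a b : R) z : fsmooth F -> fsmooth K ->
  poisson P (fun z => a * F z + b * K z) z = a * poisson P F z + b * poisson P K z.
Proof.
move=> sF sK; rewrite /poisson !mulr_sumr -big_split/=; apply: eq_bigr => k _.
rewrite /partial_p /partial_q !(derive_lin2 _ _ _ _ sF sK).
have E (v w f1 f2 k1 k2 : R) : v * (a * f1 + b * k1) - w * (a * f2 + b * k2) =
  a * (v * f1 - w * f2) + b * (v * k1 - w * k2) by ring.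
exact: E.
Qed.

Lemma poissonxx P z : poisson P P z = 0.
Proof. by rewrite /poisson big1// => k _; rewrite mulrC subrr. Qed.

Section Evolution.
Variables (F K : chart -> R) (a b : R -> R).
Hypotheses (sF : fsmooth F) (sK : fsmooth K) (pF : qperiodic F) (pK : qperiodic K).

Definition two_stage (t : R) (x : phase) : R := a t * on_phase F x + b t * on_phase K x.

Variable x : R -> phase.
Hypothesis solx : ham_solution two_stage x.

(** The curve is only lifted locally, but all functions involved are periodic in q,
so neither the lift nor the representative of the base point matters. *)
Lemma evolution P t : fsmooth P -> qperiodic P -> t \in `[0, 1] ->
  deriv01 (fun s => on_phase P (x s)) t
    (a t * poisson P F (lift_pt (x t)) + b t * poisson P K (lift_pt (x t))).
Proof.
move=> sP pP t01; have [_ [q [xq dqt dpt]]] := solx t01.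
have xqt : (x t).1 = toT (q t) by move/nbhs_singleton : xq; exact.
pose Q z := a t * F z + b t * K z.
have HQ q' p : two_stage t (toT q', p) = Q (q', p) by rewrite /two_stage !on_phase_toT.
have E1 : (\row_i coordD i (fun p => two_stage t (toT (q t), p)) (x t).2)
    = \row_i partial_p i Q (q t, (x t).2).
  have HQf : (fun p => two_stage t (toT (q t), p)) = (fun p => Q (q t, p)).
    by apply/funext => p; exact: HQ.
  by apply/rowP => i; rewrite !mxE /coordD HQf derive_snd.
have E2 : (\row_i coordD i (fun q' => two_stage t (toT q', (x t).2)) (q t))
    = \row_i partial_q i Q (q t, (x t).2).
  have HQf : (fun q' => two_stage t (toT q', (x t).2)) = (fun q' => Q (q', (x t).2)).
    by apply/funext => p; exact: HQ.
  by apply/rowP => i; rewrite !mxE /coordD HQf derive_fst.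
rewrite E1 in dqt; rewrite E2 in dpt.
have := @deriv01_comp _ _ P (fun s => (q s, (x s).2)) t _ (fsmooth_diff _ sP)
  (deriv01_pair dqt dpt).
rewrite derive_pair; last exact: fsmooth_diff.
move=> D; rewrite -poisson_lin2// -/Q.
have -> : poisson P Q (lift_pt (x t)) = \sum_(k < n)
   ((\row_i partial_p i Q (q t, (x t).2)) 0 k * partial_q k P (q t, (x t).2) +
    (- (\row_i partial_q i Q (q t, (x t).2))) 0 k * partial_p k P (q t, (x t).2)).
  have pQ : qperiodic Q by move=> r r' p e; rewrite /Q (pF _ e) (pK _ e).
  rewrite (qperiodic_poisson pP pQ (q' := q t)); last by rewrite toT_repr.
  by apply: eq_bigr => k _; rewrite !mxE; ring.
apply: deriv01_near D => /=.
  by rewrite /on_phase; apply: pP; rewrite toT_repr.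
apply: filterS xq => s h s01 /=.
by rewrite /on_phase; apply: pP; rewrite toT_repr h.
Qed.

End Evolution.
End Phase.

(** * Compactness *)

Section Compactness.
Variables (R : realType) (n : nat).
Local Notation chart := ('rV[R]_n * 'rV[R]_n)%type.

Definition sqnorm (p : 'rV[R]_n) : R := \sum_(i < n) p 0 i ^+ 2.

Lemma sqnorm_ge0 (p : 'rV[R]_n) : 0 <= sqnorm p.
Proof. by apply: sumr_ge0 => i _; exact: sqr_ge0. Qed.

Lemma enorm_lt1 p : (enorm p < 1) = (sqnorm p < 1).
Proof. by rewrite /enorm -[X in _ < X](@sqrtr1 R) ltr_sqrt. Qed.

Lemma coord_sqnorm (p : 'rV[R]_n) i : p 0 i ^+ 2 <= sqnorm p.
Proof.
by rewrite /sqnorm (bigD1 i)//= lerDl; apply: sumr_ge0 => j _; exact: sqr_ge0.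
Qed.

Lemma sqnormZ a p : sqnorm (a *: p) = a ^+ 2 * sqnorm p.
Proof. by rewrite /sqnorm mulr_sumr; apply: eq_bigr => i _; rewrite mxE exprMn. Qed.

(** Young's inequality, summed over the coordinates.  It replaces the triangle
inequality of the Euclidean norm. *)
Lemma sqnormD_le (k : R) (a b : 'rV[R]_n) : 0 < k ->
  sqnorm (a + b) <= (1 + k) * sqnorm a + (1 + k^-1) * sqnorm b.
Proof.
move=> k0; rewrite /sqnorm !mulr_sumr -big_split/=; apply: ler_sum => i _.
rewrite !mxE -subr_ge0.
have -> : (1 + k) * a 0 i ^+ 2 + (1 + k^-1) * b 0 i ^+ 2 - (a 0 i + b 0 i) ^+ 2
   = k * (a 0 i - k^-1 * b 0 i) ^+ 2.
  by field; rewrite gt_eqF.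
by rewrite mulr_ge0 ?sqr_ge0// ltW.
Qed.

Lemma sqnorm_continuous : continuous sqnorm.
Proof.
move=> x; apply: differentiable_continuous.
rewrite (_ : sqnorm = \sum_(i < n)
   ((fun h : 'rV[R]_n => h 0 i) * (fun h : 'rV[R]_n => h 0 i))); last first.
  apply/funext => h; rewrite fct_sumE /sqnorm; apply: eq_bigr => i _.
  by rewrite expr2.
by apply: differentiable_sum => i; apply: differentiableM;
  exact: differentiable_coord.
Qed.

Definition box (a b : R) : set 'rV[R]_n :=
  [set q : 'rV[R]_n | forall i, (`[a, b]%classic : set R) (q ord0 i)].

Lemma box_compact a b : compact (box a b).
Proof. exact: (@rV_compact R n (fun=> `[a, b]%classic) (fun=> @segment_compact R a b)). Qed.

Lemma toT_box (q : 'rV[R]_n) : exists2 q', box 0 1 q' & toT q' = toT q.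
Proof.
exists (\row_i (q 0 i - (Num.floor (q 0 i))%:~R)).
  move=> i /=; rewrite !mxE in_itv/=.
  have /andP[h1 h2] := floor_itv (q 0 i).
  rewrite subr_ge0 h1/= lerBlDl ltW//.
  by move: h2; rewrite intrD.
apply/toT_eqP => i; rewrite !mxE addrAC subrr add0r rpredN.
exact: intr_int.
Qed.

Lemma toT_continuous : continuous (@toT R n).
Proof. exact: (@pi_continuous _ (torus R n)). Qed.

Lemma torus_compact : compact [set: torus R n].
Proof.
have -> : [set: torus R n] = @toT R n @` box 0 1.
  apply/seteqP; split => // a _.
  by have [q' q'01 e] := toT_box (repr a); exists q' => //; rewrite e toT_repr.
apply: continuous_compact; last exact: box_compact.
exact/continuous_subspaceT/toT_continuous.
Qed.

(** Up to an integer translation q lies in the compact cube [0, 1]^n. *)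
Lemma qperiodic_bounded (P : chart -> R) : continuous P -> qperiodic P ->
  exists C, forall q p, sqnorm p <= 1 -> `|P (q, p)| <= C.
Proof.
move=> cP pP; pose A := box 0 1 `*` box (-1) 1.
have cA : compact A by apply: compact_setX; exact: box_compact.
have A0 : A !=set0.
  exists (0, 0); split => i /=; rewrite mxE in_itv/= ?lexx ?ler01//.
  by rewrite lerN10.
have cf : {within A, continuous (fun z => `|P z|)}.
  by apply: continuous_subspaceT => z; apply: cvg_norm; exact: cP.
have [c cA' cmax] := compact_EVT_max A0 cA cf.
exists `|P c| => q p p1; have [q' q'01 e] := toT_box q.
rewrite -(pP _ _ _ e); apply: cmax; rewrite inE; split => // i /=.
rewrite in_itv/= -ler_norml -(@ler_sqr _ `|_|) ?nnegrE// expr1n real_normK ?num_real//.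
exact: le_trans (coord_sqnorm _ _) p1.
Qed.

Lemma qperiodic_bounded_family (I : finType) (P : I -> chart -> R) :
  (forall i, fsmooth (P i)) -> (forall i, qperiodic (P i)) ->
  exists2 C, 0 < C & forall i q p, sqnorm p <= 1 -> `|P i (q, p)| <= C.
Proof.
move=> sP pP.
have /choice[C hC] i := qperiodic_bounded (fsmooth_continuous (sP i)) (pP i).
exists (1 + \sum_i `|C i|).
  by rewrite ltr_wpDr// sumr_ge0.
move=> i q p p1; rewrite (le_trans (hC i q p p1))// (le_trans (ler_norm _))//.
by rewrite (bigD1 i)//= addrCA lerDl addr_ge0// sumr_ge0.
Qed.

End Compactness.

(** * A function on the circle with concentrated critical points *)

Section Circle.
Variable R : realType.
Implicit Types s lam : R.

Definition cosT s : R := cos (2 * pi * s).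
Definition sinT s : R := sin (2 * pi * s).

Lemma trigT_int s s' : s - s' \is a Num.int -> cosT s = cosT s' /\ sinT s = sinT s'.
Proof.
have H (m : nat) y : cosT (y + m%:R) = cosT y /\ sinT (y + m%:R) = sinT y.
  have E : 2 * pi * (y + m%:R) = 2 * pi * y + (pi *+ 2) *+ m :> R.
    by rewrite mulrDr mulr_natr mulr_natl.
  rewrite /cosT /sinT E.
  by split; [exact: (periodicn (@cosD2pi R))|exact: (periodicn (@sinD2pi R))].
move=> /intrP[[m|m] e].
  by have := H m s'; rewrite -[m%:R]/(m%:~R) -e addrC subrK.
have [-> ->] : cosT s' = cosT s /\ sinT s' = sinT s; last by [].
have := H m.+1 s; suff -> : s + m.+1%:R = s' by [].
by rewrite -[s](subrK s') e NegzE mulrNz addrAC -pmulrn addNr add0r.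
Qed.

Lemma trigT_shift s (k : int) :
  cosT s = cosT (s - k%:~R) /\ sinT s = sinT (s - k%:~R).
Proof. by apply: trigT_int; rewrite opprB addrC subrK intr_int. Qed.

Lemma near_int s : exists k : int, `|s - k%:~R| <= 2^-1.
Proof.
exists (Num.floor (s + 2^-1)); have /andP[h1 h2] := floor_itv (s + 2^-1).
move: h2; rewrite intrD => h2.
by rewrite ler_norml; apply/andP; split; lra.
Qed.

Lemma cosT_norm s : cosT `|s| = cosT s.
Proof.
rewrite /cosT; have [?|?] := leP 0 s; first by rewrite ger0_norm.
by rewrite ltr0_norm// mulrN cosN.
Qed.

Lemma half_turn s : 0 <= s -> s <= 2^-1 -> 2 * pi * s \in `[0, pi : R].
Proof.
move=> s0 s2; have pi0 : 0 < (pi : R) by exact: pi_gt0.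
by rewrite in_itv/=; apply/andP; split; nra.
Qed.

(** The values of the cosine detect the distance to the integers. *)
Lemma cosT_near1 (rho : R) : 0 < rho ->
  exists2 c, c < 1 & forall s, c < cosT s -> exists k : int, `|s - k%:~R| < rho.
Proof.
move=> rho0; pose r := Num.min rho 2^-1.
have r0 : 0 < r by rewrite lt_min rho0/=.
have r2 : r <= 2^-1 by rewrite ge_min lexx orbT.
have rr : r <= rho by rewrite ge_min lexx.
have pi0 : 0 < (pi : R) by exact: pi_gt0.
exists (cosT r).
  rewrite -(@cos0 R) /cosT ltr_cos ?(half_turn (ltW r0) r2)//.
    by rewrite !mulr_gt0.
  by rewrite in_itv/= lexx ltW.
move=> s; have [k hk] := near_int s.
have [-> _] := trigT_shift s k.
rewrite -(cosT_norm (s - _)) /cosT.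
rewrite ltr_cos ?(half_turn (ltW r0) r2) ?(half_turn (normr_ge0 _) hk)// => h.
exists k; apply: lt_le_trans rr; move: h; nra.
Qed.

(** The arcsine provides a continuous choice of the angle as long as the cosine
stays positive. *)
Lemma asin_sinT s : 0 < cosT s ->
  exists k : int, asin (sinT s) / (2 * pi) = s - k%:~R.
Proof.
have pi0 : 0 < (pi : R) by exact: pi_gt0.
have [k hk] := near_int s => c0; exists k; move: c0.
have [-> ->] := trigT_shift s k.
set y := s - k%:~R in hk *; rewrite -cosT_norm => c0.
have h : `|y| < 4^-1.
  rewrite ltNge; apply/negP => hy; move: c0; rewrite ltNge => /negP; apply.
  rewrite -(@cos_pihalf R) /cosT leNgt ltr_cos ?half_turn//.
    by rewrite -leNgt; nra.
  by rewrite in_itv/=; apply/andP; split; lra.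
move: h; rewrite ltr_norml => /andP[y1 y2].
rewrite /sinT sinK; first by rewrite mulrC mulKf// gt_eqF// mulr_gt0.
have h1 : 0 < pi * (4^-1 - y) by rewrite mulr_gt0// subr_gt0.
have h2 : 0 < pi * (4^-1 + y) by rewrite mulr_gt0// -ltrBlDl sub0r.
rewrite in_itv/=; apply/andP; split; lra.
Qed.

(** The critical points satisfy cosT s = lam (1 - (cosT s)^2), which for large lam
forces cosT s to be close to 1, that is, s to be close to the integers. *)
Definition wave lam s : R := sinT s * expR (lam * cosT s).

Definition wave' lam s : R :=
  2 * pi * expR (lam * cosT s) * (cosT s - lam * (1 - cosT s ^+ 2)).

Lemma fsmooth_sinT : fsmooth sinT.
Proof.
rewrite (_ : sinT = sin \o ( *%R (2 * pi))); last by [].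
apply: fsmooth_comp (@fsmooth_sin R) _.
exact: (@fsmooth_linear _ _ ( *:%R (2 * pi : R))) (@scaler_continuous _ _ _).
Qed.

Lemma fsmooth_cosT : fsmooth cosT.
Proof.
rewrite (_ : cosT = cos \o ( *%R (2 * pi))); last by [].
apply: fsmooth_comp (@fsmooth_cos R) _.
exact: (@fsmooth_linear _ _ ( *:%R (2 * pi : R))) (@scaler_continuous _ _ _).
Qed.

Lemma fsmooth_wave lam : fsmooth (wave lam).
Proof.
rewrite (_ : wave lam = sinT * (expR \o (cst lam * cosT))); last by [].
apply: fsmoothM fsmooth_sinT _; apply: fsmooth_comp (@fsmooth_expR R) _.
exact: fsmoothM (@fsmooth_cst _ _ _) fsmooth_cosT.
Qed.

Lemma is_derive_sinT s : is_derive s 1 sinT (2 * pi * cosT s).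
Proof.
have d : is_derive s 1 (fun y : R => (2 * pi) * y) (2 * pi).
  by apply: (is_derive_eq (is_deriveZ _ _)); rewrite /GRing.scale/= mulr1.
apply: (is_derive_eq (is_derive1_comp (f := sin) (g := fun y => 2 * pi * y) _ _)).
by rewrite /GRing.scale/= mulrC.
Qed.

Lemma is_derive_cosT s : is_derive s 1 cosT (- (2 * pi * sinT s)).
Proof.
have d : is_derive s 1 (fun y : R => (2 * pi) * y) (2 * pi).
  by apply: (is_derive_eq (is_deriveZ _ _)); rewrite /GRing.scale/= mulr1.
apply: (is_derive_eq (is_derive1_comp (f := cos) (g := fun y => 2 * pi * y) _ _)).
by rewrite /GRing.scale/= /sinT; ring.
Qed.

Lemma wave_derive lam s : 'D_1 (wave lam) s = wave' lam s.
Proof.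
have ds := is_derive_sinT s; have dc := is_derive_cosT s.
have dl : is_derive s 1 (fun y => lam * cosT y) (lam * (- (2 * pi * sinT s))).
  exact: is_deriveZ.
have de : is_derive s 1 (fun y => expR (lam * cosT y))
   (expR (lam * cosT s) * (lam * (- (2 * pi * sinT s)))).
  apply: (is_derive_eq (is_derive1_comp (f := expR) (g := fun y => lam * cosT y) _ _)).
  by [].
have : is_derive s 1 (wave lam) (wave' lam s); last by case.
apply: (is_derive_eq (is_deriveM ds de)).
have := cos2Dsin2 (2 * pi * s); rewrite -/(cosT s) -/(sinT s) => cs.
have -> : wave' lam s = 2 * pi * expR (lam * cosT s) * (cosT s - lam * sinT s ^+ 2).
  by rewrite /wave' -cs; ring.
by rewrite /GRing.scale/=; ring.
Qed.

Lemma cosT_le1 s : -1 <= cosT s <= 1.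
Proof. by rewrite cos_le1 cos_geN1. Qed.

Lemma wave'_le lam s : 0 <= lam -> wave' lam s <= 2 * pi * expR lam.
Proof.
move=> l0; have pi0 : 0 < (pi : R) by exact: pi_gt0.
have /andP[c1 c2] := cosT_le1 s.
have el : expR (lam * cosT s) <= expR lam by rewrite ler_expR; nra.
have ep := expR_gt0 (lam * cosT s).
have cq : 0 <= (1 - cosT s) * (1 + cosT s) by apply: mulr_ge0; lra.
have cc : cosT s - lam * (1 - cosT s ^+ 2) <= 1.
  by have := mulr_ge0 l0 cq; rewrite (_ : (1 - _) * _ = 1 - cosT s ^+ 2); [lra|ring].
rewrite /wave'; apply: (@le_trans _ _ (2 * pi * expR (lam * cosT s) * 1)).
  by rewrite ler_wpM2l// !mulr_ge0// ltW.
by rewrite mulr1 ler_wpM2l// mulr_ge0// ltW.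
Qed.

(** With C = cosT s, the bound rests on the identity
lam (1 - C^2) - C - 1 = (1 + C) (lam (1 - C) - 1). *)
Lemma wave'_far c lam s : 0 <= lam -> 1 <= lam * (1 - c) -> cosT s <= c ->
  wave' lam s <= - (2 * pi * expR (- lam)).
Proof.
move=> l0 lc sc; have pi0 : 0 < (pi : R) by exact: pi_gt0.
have /andP[c1 c2] := cosT_le1 s.
have el : expR (- lam) <= expR (lam * cosT s) by rewrite ler_expR; nra.
have ep := expR_gt0 (- lam).
have lcs : 1 <= lam * (1 - cosT s).
  by apply: (le_trans lc); rewrite ler_wpM2l// lerB.
have cc : cosT s - lam * (1 - cosT s ^+ 2) <= -1.
  have : 0 <= (1 + cosT s) * (lam * (1 - cosT s) - 1) by apply: mulr_ge0; lra.
  by rewrite (_ : _ * _ = lam * (1 - cosT s ^+ 2) - 1 - cosT s); [lra|ring].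
rewrite /wave'; apply: (@le_trans _ _ (2 * pi * expR (lam * cosT s) * -1)).
  by rewrite ler_wpM2l// !mulr_ge0// ?expR_ge0// ltW.
by rewrite mulrN1 lerN2 ler_wpM2l// mulr_ge0// ltW.
Qed.

Lemma wave_int lam s s' : s - s' \is a Num.int -> wave lam s = wave lam s'.
Proof. by rewrite /wave => /trigT_int[-> ->]. Qed.

End Circle.

(** * Tubes around a section *)

Section Tube.
Variables (R : realType) (n : nat).
Local Notation chart := ('rV[R]_n * 'rV[R]_n)%type.

(** Normalised so that [ubump 1 = 1]; it vanishes exactly on the half-line s <= 0. *)
Definition ubump (s : R) : R := expR 1 * flat 0 s.

Lemma ubump_ge0 s : 0 <= ubump s.
Proof. by rewrite mulr_ge0 ?expR_ge0 ?flat_ge0. Qed.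

Lemma ubump1 : ubump 1 = 1.
Proof. by rewrite /ubump /flat ltr01 expr0 invr1 mul1r -expRD subrr expR0. Qed.

Lemma ubump_le s : ubump s <= expR 1.
Proof.
rewrite /ubump ler_piMr ?expR_ge0// /flat; case: ifPn => // s0.
by rewrite expr0 invr1 mul1r -expR0 ler_expR oppr_le0 invr_ge0 ltW.
Qed.

Lemma ubump_neq0 s : (ubump s != 0) = (0 < s).
Proof.
rewrite /ubump /flat mulf_eq0 expR_eq0/=; case: ifPn => [//|_]; last by rewrite eqxx.
by rewrite expr0 invr1 mul1r expR_eq0.
Qed.

Lemma fsmooth_ubump : fsmooth ubump.
Proof.
rewrite (_ : ubump = cst (expR 1) * flat 0); last by [].
exact: fsmoothM (@fsmooth_cst _ _ _) (@fsmooth_flat _ _).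
Qed.

Lemma ubump_half s : 2^-1 <= s -> expR (- 1) <= ubump s.
Proof.
move=> s2; have s0 : 0 < s by rewrite (lt_le_trans _ s2).
rewrite /ubump /flat s0 expr0 invr1 mul1r -expRD ler_expR.
have : s^-1 <= 2 by rewrite -(@invrK _ 2) lef_pV2 ?posrE.
lra.
Qed.

(** A point where a nonnegative function vanishes is a minimum. *)
Lemma derive_at_min0 (V : normedModType R) (f : V -> R) z v :
  fsmooth f -> (forall y, 0 <= f y) -> f z = 0 -> 'D_v f z = 0.
Proof.
move=> sf f0 fz.
have df s := is_derive_line
  (diff_derivable (fsmooth_diff (s *: v + z) sf) : derivable f (s *: v + z) v).
have : is_derive (0 : R) 1 (fun s : R => f (s *: v + z)) 0.
  apply: (@derive1_at_min _ _ (-1) 1) => //.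
  - by rewrite in_itv/= ltrN10 ltr01.
  - by move=> t _; rewrite scale0r add0r fz.
by case=> _; have [_ ->] := df 0; rewrite scale0r add0r.
Qed.

Lemma fsmooth_fst (f : 'rV[R]_n -> R) : fsmooth f -> fsmooth (fun z : chart => f z.1).
Proof. by move=> sf; apply: (@fsmooth_pullback _ _ _ fst f) => // z; exact: cvg_fst. Qed.

Lemma fsmooth_snd (f : 'rV[R]_n -> R) : fsmooth f -> fsmooth (fun z : chart => f z.2).
Proof. by move=> sf; apply: (@fsmooth_pullback _ _ _ snd f) => // z; exact: cvg_snd. Qed.

Lemma coord_linear (i : 'I_n) : linear (fun p : 'rV[R]_n => p 0 i).
Proof. by move=> a v w; rewrite !mxE. Qed.

Lemma fsmooth_coord (i : 'I_n) : fsmooth (fun p : 'rV[R]_n => p 0 i).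
Proof.
pose LM := GRing.isLinear.Build _ _ _ _ _ (coord_linear i).
pose L : {linear 'rV[R]_n -> R} := HB.pack (fun p : 'rV[R]_n => p 0 i) LM.
by apply: (@fsmooth_linear _ _ L); have := @coord_continuous R 1 n 0 i; exact.
Qed.

Lemma derive_coord (i : 'I_n) (p v : 'rV[R]_n) :
  'D_v (fun p : 'rV[R]_n => p 0 i) p = v 0 i.
Proof.
pose LM := GRing.isLinear.Build _ _ _ _ _ (coord_linear i).
pose L : {linear 'rV[R]_n -> R} := HB.pack (fun p : 'rV[R]_n => p 0 i) LM.
rewrite deriveE; last exact: fsmooth_diff (fsmooth_coord i).
by rewrite (@diff_lin _ _ _ L)//; have := @coord_continuous R 1 n 0 i; exact.
Qed.

Lemma derive_of_snd (f : 'rV[R]_n -> R) (z v : chart) :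
  'D_v (fun z : chart => f z.2) z = 'D_v.2 f z.2.
Proof. by []. Qed.

Variable u : torus R n -> 'rV[R]_n.
Hypothesis su : smooth_torus u.

Definition ucoord (i : 'I_n) (q : 'rV[R]_n) : R := u (toT q) 0 i.

Lemma fsmooth_ucoord i : fsmooth (ucoord i).
Proof. exact/smooth_fsmooth/(smooth_coord i su). Qed.

Definition offset (i : 'I_n) (z : chart) : R := z.2 0 i - ucoord i z.1.

Lemma fsmooth_offset i : fsmooth (offset i).
Proof.
exact: (fsmoothB (fsmooth_snd (fsmooth_coord i)) (fsmooth_fst (fsmooth_ucoord i))).
Qed.

Lemma qperiodic_offset i : qperiodic (offset i).
Proof. by move=> q q' p e; rewrite /offset /ucoord /= e. Qed.

Lemma derive_offset i (z v : chart) :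
  'D_v (offset i) z = v.2 0 i - 'D_v.1 (ucoord i) z.1.
Proof.
rewrite (_ : offset i = (fun z : chart => z.2 0 i) - (fun z : chart => ucoord i z.1))//.
rewrite deriveB; first by rewrite (derive_of_snd (fun p => p 0 i)) derive_coord.
  exact/diff_derivable/fsmooth_diff/(fsmooth_snd (fsmooth_coord i)).
exact/diff_derivable/fsmooth_diff/(fsmooth_fst (fsmooth_ucoord i)).
Qed.

Definition fibre_dist2 (z : chart) : R := \sum_(i < n) offset i z ^+ 2.

Lemma fibre_dist2E q p : fibre_dist2 (q, p) = sqnorm (p - u (toT q)).
Proof. by apply: eq_bigr => i _; rewrite !mxE. Qed.

Lemma fibre_dist2_ge0 z : 0 <= fibre_dist2 z.
Proof. by apply: sumr_ge0 => i _; exact: sqr_ge0. Qed.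

Lemma fsmooth_fibre_dist2 : fsmooth fibre_dist2.
Proof.
rewrite (_ : fibre_dist2 = fun z => \sum_(i < n) (offset i * offset i) z).
  by apply: fsmooth_sum => i; apply: fsmoothM; exact: fsmooth_offset.
by apply/funext => z; apply: eq_bigr => i _; rewrite expr2.
Qed.

Definition tube (d : R) (z : chart) : R := ubump (1 - fibre_dist2 z / d ^+ 2).

Lemma fsmooth_tube d : fsmooth (tube d).
Proof.
rewrite (_ : tube d = ubump \o (cst 1 - fibre_dist2 * cst (d ^- 2))) //.
apply: fsmooth_comp fsmooth_ubump _; apply: fsmoothB (@fsmooth_cst _ _ _) _.
exact: fsmoothM fsmooth_fibre_dist2 (@fsmooth_cst _ _ _).
Qed.

Lemma qperiodic_tube d : qperiodic (tube d).
Proof.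
move=> q q' p e; rewrite /tube; congr (ubump (1 - _ / _)).
by apply: eq_bigr => i _; rewrite (qperiodic_offset _ _ e).
Qed.

Lemma tube_ge0 d z : 0 <= tube d z.
Proof. exact: ubump_ge0. Qed.

Lemma tube_neq0 d z : 0 < d -> (tube d z != 0) = (fibre_dist2 z < d ^+ 2).
Proof.
move=> d0; rewrite /tube ubump_neq0 subr_gt0 ltr_pdivrMr ?mul1r//.
exact: exprn_gt0.
Qed.

Lemma tube_core d z : fibre_dist2 z = 0 -> tube d z = 1.
Proof. by rewrite /tube => ->; rewrite mul0r subr0 ubump1. Qed.

Lemma derive_tube_core d z v : fibre_dist2 z = 0 -> 'D_v (tube d) z = 0.
Proof.
move=> z0; pose f : chart -> R := cst 1 - fibre_dist2 * cst (d ^- 2).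
have sf : fsmooth f.
  exact: fsmoothB (@fsmooth_cst _ _ _) (fsmoothM fsmooth_fibre_dist2 (@fsmooth_cst _ _ _)).
rewrite (_ : tube d = ubump \o f)//.
rewrite derive_comp1; [|exact: fsmooth_diff|exact/fsmooth_diff/fsmooth_ubump].
suff -> : 'D_v f z = 0 by rewrite mulr0.
have dd : derivable fibre_dist2 z v by exact/diff_derivable/fsmooth_diff/fsmooth_fibre_dist2.
have dc : derivable (cst (d ^- 2) : chart -> R) z v by exact: derivable_cst.
have d1 : derivable (cst 1 : chart -> R) z v by exact: derivable_cst.
rewrite /f (deriveB d1 (derivableM dd dc)) derive_cst sub0r (deriveM dd dc).
rewrite derive_cst scaler0 add0r.
by rewrite (derive_at_min0 _ fsmooth_fibre_dist2 fibre_dist2_ge0 z0) scaler0 oppr0.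
Qed.

Lemma tube_deriv_out d z v : tube d z = 0 -> 'D_v (tube d) z = 0.
Proof. exact: derive_at_min0 (fsmooth_tube d) (@tube_ge0 d). Qed.

(** The section has compact image in the open unit ball bundle, hence a tube around
it stays away from the boundary. *)
Lemma section_tube : (forall q, unitCotangent (q, u q)) ->
  exists2 D, 0 < D & exists2 rho, rho < 1 & forall q p,
    fibre_dist2 (q, p) < D ^+ 2 -> sqnorm p <= rho.
Proof.
move=> uM.
pose f (q : 'rV[R]_n) : R := \sum_(i < n) ucoord i q ^+ 2.
have fE q : f q = sqnorm (u (toT q)) by [].
have cf : continuous f.
  rewrite (_ : f = fun z => \sum_(i < n) (ucoord i * ucoord i) z).
    apply: fsmooth_continuous; apply: fsmooth_sum => i; apply: fsmoothM; exact: fsmooth_ucoord.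
  by apply/funext => z; apply: eq_bigr => i _; rewrite expr2.
have A0 : (box 0 1 : set 'rV[R]_n) !=set0 by exists 0 => i /=; rewrite mxE in_itv/= lexx ler01.
have [c _ cmax] := compact_EVT_max A0 (@box_compact R n 0 1) (continuous_subspaceT cf).
have s1 : f c < 1 by rewrite fE -enorm_lt1; exact: uM.
have s0 : 0 <= f c by rewrite fE sqnorm_ge0.
pose s := f c; rewrite -/s in s0 s1 cmax.
have fs q : sqnorm (u (toT q)) <= s.
  have [q' q'01 e] := toT_box q.
  by rewrite -e -fE; apply: cmax; rewrite inE.
pose k := (1 - s) / 2.
have k0 : 0 < k by rewrite divr_gt0// subr_gt0.
pose D := (1 - s) / 4 / (1 + k^-1).
have kv : 0 < 1 + k^-1 by rewrite addr_gt0// invr_gt0.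
have D0 : 0 < D by rewrite !divr_gt0// subr_gt0.
exists (Num.sqrt D); first by rewrite sqrtr_gt0.
exists ((1 + k) * s + (1 - s) / 4); first by rewrite /k; nra.
move=> q p; rewrite sqr_sqrtr ?(ltW D0)// fibre_dist2E => h.
have -> : p = u (toT q) + (p - u (toT q)) by rewrite addrCA subrr addr0.
apply: le_trans (sqnormD_le _ _ k0) _; apply: lerD.
  by rewrite ler_wpM2l// addr_ge0// ltW.
have -> : (1 - s) / 4 = (1 + k^-1) * D by rewrite /D [RHS]mulrC divfK// gt_eqF.
by rewrite ler_wpM2l// ltW.
Qed.

End Tube.

(** * A kick transverse to the section *)

Section Kick.
Variables (R : realType) (n : nat).
Local Notation chart := ('rV[R]_n * 'rV[R]_n)%type.
Variable u : torus R n -> 'rV[R]_n.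
Hypothesis su : smooth_torus u.
Variables (i0 j0 : 'I_n) (a : 'rV[R]_n).
Local Notation ucoord := (ucoord u).
Local Notation offset := (offset u).
Local Notation fibre_dist2 := (fibre_dist2 u).
Local Notation tube := (tube u).

(** The components (i, i0) of the exterior derivative of the 1-form sum_i u_i dq_i. *)
Definition twist (i : 'I_n) (q : 'rV[R]_n) : R :=
  'D_(delta_mx 0 i) (ucoord i0) q - 'D_(delta_mx 0 i0) (ucoord i) q.

Lemma fsmooth_twist i : fsmooth (twist i).
Proof. by apply: fsmoothB; apply: fsmooth_derive; exact: fsmooth_ucoord. Qed.

Lemma derive_toT (f : 'rV[R]_n -> R) v :
  (forall q q', toT q = toT q' -> f q = f q') ->
  forall q q', toT q = toT q' -> 'D_v f q = 'D_v f q'.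
Proof.
move=> pf q q' e; pose P (z : chart) := f z.1.
have pP : qperiodic P by move=> r r' p er; exact: pf.
exact: (qperiodic_derive (v, 0) pP 0 e).
Qed.

Lemma twist_toT i q q' : toT q = toT q' -> twist i q = twist i q'.
Proof.
by move=> e; rewrite /twist; congr (_ - _); apply: derive_toT => // r r' er;
  rewrite /ucoord er.
Qed.

Variables (lam N : R) (L : 'I_n -> R).

Definition height (q : 'rV[R]_n) : R := \sum_(i < n) L i * wave lam (q 0 i - a 0 i).

Lemma fsmooth_height_term i : fsmooth (fun q : 'rV[R]_n => wave lam (q 0 i - a 0 i)).
Proof.
exact: (fsmooth_comp (fsmooth_wave lam) (fsmoothB (fsmooth_coord i) (@fsmooth_cst _ _ (a 0 i)))).
Qed.

Lemma fsmooth_height : fsmooth height.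
Proof.
apply: (@fsmooth_sum _ _ _ (fun i (q : 'rV[R]_n) => L i * wave lam (q 0 i - a 0 i))) => i.
exact: (fsmoothM (@fsmooth_cst _ _ (L i)) (fsmooth_height_term i)).
Qed.

Lemma height_toT q q' : toT q = toT q' -> height q = height q'.
Proof.
move=> /toT_eqP e; apply: eq_bigr => i _; congr (_ * _); apply: wave_int.
by rewrite opprB addrA subrK e.
Qed.

Lemma derive_height v q :
  'D_v height q = \sum_(i < n) v 0 i * (L i * wave' lam (q 0 i - a 0 i)).
Proof.
rewrite (_ : height = \sum_(i < n)
    (L i *: (fun q : 'rV[R]_n => wave lam (q 0 i - a 0 i)))); last first.
  by apply/funext => q'; rewrite fct_sumE.
have d i : derivable (fun q : 'rV[R]_n => wave lam (q 0 i - a 0 i)) q v.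
  exact/diff_derivable/fsmooth_diff/fsmooth_height_term.
rewrite derive_sum; last by move=> i; exact: derivableZ.
apply: eq_bigr => i _; rewrite deriveZ// /GRing.scale/= mulrCA; congr (_ * _).
have sc := fsmoothB (fsmooth_coord i) (@fsmooth_cst _ 'rV[R]_n (a 0 i)).
have := @derive_comp1 _ _ (wave lam) _ q v (fsmooth_diff q sc) (fsmooth_diff _ (fsmooth_wave lam)).
rewrite wave_derive => ->; rewrite mulrC; congr (_ * _).
rewrite deriveB; [|exact/diff_derivable/fsmooth_diff/fsmooth_coord|exact: derivable_cst].
by rewrite derive_cst subr0 derive_coord.
Qed.

Variables (D A : R).

(** Its linear part in the fibre direction i0 is what rotates the differential of
the height by the exterior derivative of sum_i u_i dq_i. *)
Definition ramp : chart -> R :=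
  (fun z => A + height z.1) + (fun z => N * twist j0 z.1) * offset i0.

Definition kick : chart -> R := tube D * ramp.

Lemma fsmooth_ramp : fsmooth ramp.
Proof.
apply: fsmoothD.
  exact: (fsmoothD (@fsmooth_cst _ _ A) (fsmooth_fst fsmooth_height)).
apply: fsmoothM; last exact: fsmooth_offset.
exact: (fsmoothM (@fsmooth_cst _ _ N) (fsmooth_fst (fsmooth_twist j0))).
Qed.

Lemma fsmooth_kick : fsmooth kick.
Proof. by apply: fsmoothM; [exact: fsmooth_tube|exact: fsmooth_ramp]. Qed.

Lemma qperiodic_kick : qperiodic kick.
Proof.
move=> q q' p e; rewrite /kick /ramp !fctE.
rewrite (qperiodic_tube u D p e) (qperiodic_offset u i0 p e) /=.
by rewrite (height_toT e) (twist_toT _ e).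
Qed.

Lemma fibre_dist2_offset z i : fibre_dist2 z = 0 -> offset i z = 0.
Proof.
move=> z0; apply/eqP; rewrite -sqrf_eq0 eq_le sqr_ge0 andbT -z0.
by rewrite /fibre_dist2 (bigD1 i)//= lerDl; apply: sumr_ge0 => j _; exact: sqr_ge0.
Qed.

(** On the section the cut-off equals 1 and is stationary, so it can be ignored. *)
Lemma derive_kick (z v : chart) : fibre_dist2 z = 0 ->
  'D_v kick z = 'D_v.1 height z.1 + N * twist j0 z.1 * 'D_v (offset i0) z.
Proof.
move=> z0.
have dh : derivable (fun z : chart => A + height z.1) z v.
  exact/diff_derivable/fsmooth_diff/(fsmoothD (@fsmooth_cst _ _ A) (fsmooth_fst fsmooth_height)).
have dt : derivable (fun z : chart => N * twist j0 z.1) z v.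
  exact/diff_derivable/fsmooth_diff/(fsmoothM (@fsmooth_cst _ _ N) (fsmooth_fst (fsmooth_twist j0))).
have dr : derivable (offset i0) z v by exact/diff_derivable/fsmooth_diff/fsmooth_offset.
have dT : derivable (tube D) z v by exact/diff_derivable/fsmooth_diff/fsmooth_tube.
have dR : derivable ramp z v by exact/diff_derivable/fsmooth_diff/fsmooth_ramp.
rewrite (deriveM dT dR) (derive_tube_core su _ _ z0) scaler0 addr0.
rewrite (tube_core _ z0) scale1r (deriveD dh (derivableM dt dr)).
rewrite (deriveM dt dr) (fibre_dist2_offset _ z0) scale0r addr0; congr (_ + _).
have dh' : derivable (fun z : chart => height z.1) z v.
  exact/diff_derivable/fsmooth_diff/(fsmooth_fst fsmooth_height).
rewrite (_ : (fun z => _) = cst A + (fun z : chart => height z.1)); last by [].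
by rewrite (deriveD (derivable_cst A z v) dh') derive_cst add0r.
Qed.

Lemma poisson_kick z i : fibre_dist2 z = 0 ->
  poisson (offset i) kick z =
  - (L i * wave' lam (z.1 0 i - a 0 i)) + N * twist j0 z.1 * twist i z.1.
Proof.
move=> z0; rewrite /poisson sumrB.
transitivity (- (N * twist j0 z.1) * 'D_(delta_mx 0 i0) (ucoord i) z.1 -
    (L i * wave' lam (z.1 0 i - a 0 i)
     - N * twist j0 z.1 * 'D_(delta_mx 0 i) (ucoord i0) z.1)); last first.
  by rewrite /(twist i); ring.
congr (_ - _).
- rewrite (bigD1 i0)//= big1 ?addr0 => [|k ki].
    rewrite /partial_q /partial_p !(derive_kick _ z0) !(derive_offset su) /= !derive0 !mxE !eqxx/=.
    by ring.
  rewrite /partial_q /partial_p !(derive_kick _ z0) !(derive_offset su) /= !derive0 !mxE.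
  by rewrite (eq_sym i0) (negbTE ki) andbF subr0 mulr0 addr0 mulr0.
- rewrite (bigD1 i)//= big1 ?addr0 => [|k ki].
    rewrite /partial_q /partial_p !(derive_kick _ z0) !(derive_offset su) /= !derive0 !mxE !eqxx/=.
    rewrite derive_height (bigD1 i)//= big1 ?addr0 => [|k ki].
      by rewrite mxE !eqxx/=; ring.
    by rewrite mxE (negbTE ki) andbF mul0r.
  rewrite /partial_p !(derive_offset su) /= !derive0 !mxE.
  by rewrite (eq_sym i) (negbTE ki) andbF subr0 mul0r.
Qed.

End Kick.

Section Transversality.
Variables (R : realType) (n : nat).
Local Notation chart := ('rV[R]_n * 'rV[R]_n)%type.
Variable u : torus R n -> 'rV[R]_n.
Hypothesis su : smooth_torus u.

(** Each angle is declared near when its cosine exceeds c.  If the angle i0 is far,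
component i0 is positive because [twist i0] vanishes; if the angle j0 is far,
component j0 is positive because the twist contributes a square.  If another
angle k is far, component k is positive because its slope Lam was taken large
with respect to N.  If all angles are near, then q is near a modulo Z^n and
N (twist j0)^2 dominates the slope of the wave in direction j0. *)
Lemma kick_transversality (i0 j0 : 'I_n) (a : 'rV[R]_n) :
  twist u i0 j0 a != 0 ->
  exists lam N (L : 'I_n -> R), exists2 d, 0 < d & forall q : 'rV[R]_n, exists i,
    d <= - (L i * wave' lam (q 0 i - a 0 i)) + N * twist u i0 j0 q * twist u i0 i q.
Proof.
move=> tw0.
have ij : i0 != j0.
  by apply: contra_neq tw0 => <-; rewrite /twist subrr.
pose Om := twist u i0 j0; pose m := Om a ^+ 2 / 2.
have m0 : 0 < m by rewrite divr_gt0// exprn_even_gt0.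
have [rho rho0 Hrho] : exists2 rho, 0 < rho &
    forall q : 'rV[R]_n, `|a - q| < rho -> m <= Om q ^+ 2.
  have sOm2 := fsmoothM (fsmooth_twist su i0 j0) (fsmooth_twist su i0 j0).
  have /cvgrPdist_lt/(_ m m0)/nbhs_normP[r /= r0 Hr] := fsmooth_continuous sOm2 (x := a).
  exists r => // q /Hr; rewrite !fctE -/Om -!expr2 => /(le_lt_trans (ler_norm _)).
  by rewrite [in X in X -> _](_ : Om a ^+ 2 = m + m) /m; [lra|lra].
have [c c1 Hc] := cosT_near1 rho0.
pose lam := (1 - Num.max c 0)^-1.
have [C C0 HC] := @qperiodic_bounded_family R n 'I_n
  (fun i (z : chart) => Om z.1 * twist u i0 i z.1)
  (fun i => fsmooth_fst (fsmoothM (fsmooth_twist su i0 j0) (fsmooth_twist su i0 i)))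
  (fun i q q' p e => congr2 *%R (twist_toT _ _ _ e) (twist_toT _ _ _ e)).
have mc : Num.max c 0 < 1 by rewrite gt_max c1 ltr01.
have lam0 : 0 < lam by rewrite invr_gt0 subr_gt0.
have lamc : 1 <= lam * (1 - c).
  rewrite /lam mulrC ler_pdivlMr ?subr_gt0// mul1r lerB// le_max lexx//.
(* - d bounds from above the slope of the wave far from the integers, and M
   bounds it everywhere *)
pose d := 2 * pi * expR (- lam).
pose M := 2 * pi * expR lam.
have pi0 : 0 < (pi : R) by exact: pi_gt0.
have d0 : 0 < d by rewrite !mulr_gt0 ?expR_gt0.
have M0 : 0 < M by rewrite !mulr_gt0 ?expR_gt0.
pose N := (M + d) / m.
have N0 : 0 < N by rewrite divr_gt0// addr_gt0.
pose Lam := (N * C + d) / d.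
have Lam0 : 0 < Lam by rewrite divr_gt0// addr_gt0// mulr_gt0.
pose L (i : 'I_n) := if (i == i0) || (i == j0) then 1 else Lam.
exists lam, N, L, d => // q.
have [h|/existsNP[i /negP]] := pselect (forall i, c < cosT (q 0 i - a 0 i)).
  (* k collects the integers to be subtracted from q to come close to a *)
  exists j0.
  have /choice[k hk] i := Hc _ (h i).
  have OmE : Om q = Om (q - \row_i (k i)%:~R).
    apply: twist_toT; apply/toT_eqP => i.
    by rewrite !mxE opprB addrC subrK intr_int.
  have Om2 : m <= Om q ^+ 2.
    rewrite OmE; apply: Hrho.
    rewrite [ltLHS]/Num.Def.normr/= mx_normrE; apply: bigmax_lt => // -[x i] _.
    rewrite ord1 !mxE/= distrC; have := hk i.
    by rewrite addrAC.
  rewrite -/Om -mulrA -expr2 /L eqxx orbT mul1r.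
  have h1 := wave'_le (q 0 j0 - a 0 j0) (ltW lam0).
  have h2 : M + d <= N * Om q ^+ 2.
    by rewrite -[X in X <= _](divfK (lt0r_neq0 m0)) -/N ler_wpM2l// ltW.
  rewrite -/M in h1; lra.
rewrite -leNgt => ci.
have far k : cosT (q 0 k - a 0 k) <= c -> d <= - wave' lam (q 0 k - a 0 k).
  by move=> ck; rewrite lerNr; exact: wave'_far (ltW lam0) lamc ck.
have [e|ne0] := eqVneq i i0.
  have tw00 : twist u i0 i0 q = 0 by rewrite /twist subrr.
  by exists i; rewrite /L e eqxx mul1r tw00 mulr0 addr0 far// -e.
have [e|ne1] := eqVneq i j0.
  exists i; rewrite /L e eqxx orbT mul1r -mulrA -expr2 -/Om.
  have := far _ ci; have : 0 <= N * Om q ^+ 2 by rewrite mulr_ge0 ?sqr_ge0// ltW.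
  rewrite e; lra.
exists i; rewrite /L (negbTE ne0) (negbTE ne1)/= -mulrN.
have h1 : Lam * d <= Lam * - wave' lam (q 0 i - a 0 i).
  by rewrite ler_wpM2l ?far// ltW.
have h2 : Lam * d = N * C + d by rewrite /Lam divfK// gt_eqF.
have h3 : - (N * C) <= N * twist u i0 j0 q * twist u i0 i q.
  rewrite -mulrN -mulrA ler_wpM2l ?(ltW N0)//.
  have := HC i q 0; rewrite /sqnorm big1 => [/(_ ler01)|k _]; last by rewrite mxE expr0n.
  by rewrite ler_norml /= => /andP[].
lra.
Qed.

End Transversality.

(** * Contracting loops of small extent *)

Section Contraction.
Variables (R : realType) (n : nat).
Local Notation chart := ('rV[R]_n * 'rV[R]_n)%type.
Local Notation phase := (torus R n * 'rV[R]_n)%type.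

Lemma cvg_row (T : Type) (G : set_system T) (f : T -> 'rV[R]_n) (l : 'rV[R]_n) :
  Filter G -> (forall i, (fun x => f x 0 i) @ G --> l 0 i) -> f @ G --> l.
Proof.
move=> FG h; apply/cvgrPdist_lt => e e0.
have : \forall x \near G, forall i, `|l 0 i - f x 0 i| < e.
  have hi i : \forall x \near G, `|l 0 i - f x 0 i| < e.
    by have /cvgrPdist_lt := h i; exact.
  have := filter_forall _ hi; exact.
apply: filterS => x hx.
rewrite [ltLHS]/Num.Def.normr/= mx_normrE; apply: bigmax_lt => // -[y i] _.
by rewrite ord1 !mxE.
Qed.

Definition cosdist (q0 : 'rV[R]_n) i (z : chart) : R := cosT (z.1 0 i - q0 0 i).
Definition sindist (q0 : 'rV[R]_n) i (z : chart) : R := sinT (z.1 0 i - q0 0 i).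

Lemma trigdist_int (q q' q0 : 'rV[R]_n) i : toT q = toT q' ->
  (q 0 i - q0 0 i) - (q' 0 i - q0 0 i) \is a Num.int.
Proof. by move=> /toT_eqP e; rewrite opprB addrA subrK e. Qed.

Lemma qperiodic_sindist q0 i : qperiodic (sindist q0 i).
Proof. by move=> q q' p e; case: (trigT_int (trigdist_int q0 i e)). Qed.

Lemma qperiodic_cosdist q0 i : qperiodic (cosdist q0 i).
Proof. by move=> q q' p e; case: (trigT_int (trigdist_int q0 i e)). Qed.

Lemma fsmooth_sindist q0 i : fsmooth (sindist q0 i).
Proof.
exact: (fsmooth_comp (@fsmooth_sinT R)
  (fsmooth_fst (fsmoothB (fsmooth_coord i) (@fsmooth_cst _ _ (q0 0 i))))).
Qed.

Lemma fsmooth_cosdist q0 i : fsmooth (cosdist q0 i).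
Proof.
exact: (fsmooth_comp (@fsmooth_cosT R)
  (fsmooth_fst (fsmoothB (fsmooth_coord i) (@fsmooth_cst _ _ (q0 0 i))))).
Qed.

Lemma poisson_cosdist (q0 : 'rV[R]_n) i (P : chart -> R) (z : chart) :
  poisson (cosdist q0 i) P z = - (2 * pi * sindist q0 i z) * partial_p i P z.
Proof.
have sc : fsmooth (fun q : 'rV[R]_n => q 0 i - q0 0 i).
  exact: fsmoothB (fsmooth_coord i) (@fsmooth_cst _ _ (q0 0 i)).
pose g (q : 'rV[R]_n) := cosT (q 0 i - q0 0 i).
have dg v q : 'D_v g q = - (2 * pi * sinT (q 0 i - q0 0 i)) * v 0 i.
  have := @derive_comp1 _ _ (@cosT R) _ q v (fsmooth_diff q sc) (fsmooth_diff _ (@fsmooth_cosT R)).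
  have [_ ->] := is_derive_cosT (q 0 i - q0 0 i) => ->; congr (_ * _).
  rewrite deriveB; [|exact/diff_derivable/fsmooth_diff/fsmooth_coord|exact: derivable_cst].
  by rewrite derive_cst subr0 derive_coord.
have E v : 'D_v (cosdist q0 i) z = 'D_v.1 g z.1 by [].
rewrite /poisson (bigD1 i)//= big1 ?addr0 => [|k ki].
  by rewrite {1}/partial_q {2}/partial_p !E !dg/= !mxE !eqxx/= mulr1 mulr0 mul0r subr0.
rewrite {1}/partial_q {2}/partial_p !E !dg/= !mxE eq_sym (negbTE ki) andbF.
by rewrite !mulr0 !mul0r subrr.
Qed.

Lemma poisson_cosdist_le (q0 : 'rV[R]_n) i (P : chart -> R) (z : chart) M :
  `|partial_p i P z| <= M ->
  `|poisson (cosdist q0 i) P z| <= 2 * pi * M.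
Proof.
move=> PM; rewrite poisson_cosdist normrM normrN normrM.
have pi0 : 0 < (pi : R) by exact: pi_gt0.
have pi20 : 0 <= 2 * pi :> R by rewrite mulr_ge0// ltW.
rewrite (ger0_norm pi20) -mulrA ler_wpM2l//.
have s1 : `|sindist q0 i z| <= 1 by rewrite ler_norml sin_le1 sin_geN1.
by rewrite -[leRHS]mul1r; apply: ler_pM.
Qed.

(** If all angles stay within a quarter turn of their initial value, then
q0 + asin(sin(2 pi (q - q0))) / (2 pi) is a continuous lift of the loop, and the
homotopy shrinks this lift to q0 and the fibre coordinate to 0. *)
Lemma contractible_small (x : R -> phase) :
  (forall P, fsmooth P -> qperiodic P ->
     {within `[0, 1], continuous (fun t => on_phase P (x t))}) ->
  (forall t, t \in `[0, 1] -> unitCotangent (x t)) -> x 1 = x 0 ->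
  (forall t i, t \in `[0, 1] -> 0 < on_phase (cosdist (repr (x 0).1) i) (x t)) ->
  contractible_loop (@unitCotangent R n) x.
Proof.
move=> cx xM x10 xc; pose q0 := repr (x 0).1; rewrite -/q0 in xc.
have pi0 : 0 < (pi : R) by exact: pi_gt0.
pose A t i := asin (on_phase (sindist q0 i) (x t)) / (2 * pi).
pose F (z : R * R) : phase :=
  (toT (\row_i (q0 0 i + (1 - z.1) * A z.2 i)), (1 - z.1) *: (x z.2).2).
(* at time 0 of the homotopy, the lift differs from q by integers *)
have F0 t : t \in `[0, 1] -> F (0, t) = x t.
  move=> t01; rewrite /F /= subr0 scale1r [RHS]surjective_pairing; congr (_, _).
  rewrite -[RHS]toT_repr; apply/toT_eqP => i; rewrite !mxE mul1r.
  have [k] := asin_sinT (xc t i t01).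
  rewrite -/(sindist q0 i (lift_pt (x t))) -/(on_phase (sindist q0 i) (x t)) -/(A t i) => ->.
  rewrite (_ : _ - _ = - k%:~R) ?rpredN ?intr_int//.
  by rewrite /=; ring.
exists F; split.
- apply/subspace_continuousP => -[s t] [s01 t01] /=.
  pose G := within (`[0, 1]%classic `*` `[0, 1]%classic) (nbhs (s, t)).
  have G1 : (fun z : R * R => 1 - z.1) @ G --> 1 - s.
    apply: cvg_within_filter; apply: cvgB; first exact: cvg_cst.
    exact: cvg_fst.
  have G2 : snd @ G --> within `[0, 1] (nbhs t).
    move=> B hB; have c2 : snd @ nbhs (s, t) --> nbhs t by exact: cvg_snd.
    suff : nbhs (s, t) [set z | (`[0, 1]%classic `*` `[0, 1]%classic) z -> B z.2].
      by [].
    have : nbhs (s, t) (snd @^-1` [set y : R | `[0, 1]%classic y -> B y]) by exact: c2.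
    by apply: filterS => -[s' t'] /= h [_ ?]; exact: h.
  have cP P : fsmooth P -> qperiodic P ->
      (fun z : R * R => on_phase P (x z.2)) @ G --> on_phase P (x t).
    move=> sP pP; have /subspace_continuousP/(_ t t01) := cx P sP pP.
    exact: cvg_comp.
  have FG : Filter G by exact: within_filter.
  have cA : (fun z : R * R => \row_i (q0 0 i + (1 - z.1) * A z.2 i)) @ G -->
      \row_i (q0 0 i + (1 - s) * A t i).
    apply: cvg_row => i; rewrite mxE.
    under eq_fun do rewrite mxE.
    apply: cvgD; first exact: cvg_cst.
    apply: cvgM => //; apply: cvgM; last exact: cvg_cst.
    apply: continuous_cvg; last first.
      by apply: cP; [exact: fsmooth_sindist|exact: qperiodic_sindist].
    apply: continuous_asin; rewrite -ltr_norml.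
    have := xc t i t01; rewrite /on_phase /cosdist /sindist /cosT /sinT => c0.
    have := cos2Dsin2 (2 * pi * ((lift_pt (x t)).1 0 i - q0 0 i)).
    move: c0; set cc := cos _; set ss := sin _ => c0 cs.
    rewrite -(@ltr_sqr _ `|_|) ?nnegrE// expr1n real_normK ?num_real//.
    by rewrite -cs ltrDr exprn_gt0.
  have cT : (fun z => (F z).1) @ G --> (F (s, t)).1.
    exact: (continuous_cvg _ (@toT_continuous R n _) cA).
  have cp : (fun z => (F z).2) @ G --> (F (s, t)).2.
    apply: cvg_row => i; rewrite mxE.
    under eq_fun do rewrite mxE.
    apply: cvgM => //.
    apply: (cP (fun z : chart => z.2 0 i)); first exact: (fsmooth_snd (fsmooth_coord i)).
    by move=> *.
  exact: (cvg_pair cT cp).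
- move=> s t s01 t01; rewrite /unitCotangent /= enorm_lt1 sqnormZ.
  have := xM t t01; rewrite /unitCotangent/= enorm_lt1.
  apply: le_lt_trans; rewrite ler_piMl ?sqnorm_ge0//.
  move: s01; rewrite in_itv/= => /andP[s0 s1].
  by rewrite expr_le1// ?subr_ge0// lerBlDl lerDr.
- exact: F0.
- exists (toT q0, 0) => t _; rewrite /F/= subrr scale0r; congr (toT _, _).
  by apply/rowP => i; rewrite mxE mul0r addr0.
- by move=> s _; rewrite /F /A /= x10.
Qed.

End Contraction.

(** * Closed orbits of a two-stage Hamiltonian *)

Section Dynamics.
Variables (R : realType) (n : nat).
Local Notation chart := ('rV[R]_n * 'rV[R]_n)%type.
Local Notation phase := (torus R n * 'rV[R]_n)%type.
Variable u : torus R n -> 'rV[R]_n.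
Hypothesis su : smooth_torus u.
Local Notation offset := (offset u).
Local Notation fibre_dist2 := (fibre_dist2 u).

Variables (F : chart -> R) (a b : R -> R).
Variables (delta c c' tau sigma d C CK : R).
Local Notation K := (tube u delta).
Hypotheses (sF : fsmooth F) (pF : qperiodic F).
(* a carries the kick F and dies out at time tau + sigma; b carries the tube K
   and starts at time tau *)
Hypotheses (c0 : 0 < c) (tau0 : 0 < tau) (sig0 : 0 < sigma) (ts1 : tau + sigma <= 1).
Hypotheses (a_ge : forall t, t <= tau -> c <= a t)
  (a_bd : forall t, 0 <= a t <= c') (a_0 : forall t, tau + sigma <= t -> a t = 0)
  (b_bd : forall t, 0 <= b t <= c') (b_0 : forall t, t <= tau -> b t = 0).
Hypotheses (del0 : 0 < delta)
  (near1 : forall q p, fibre_dist2 (q, p) < delta ^+ 2 -> sqnorm p <= 1).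
Hypothesis transF : forall q, exists i, d <= poisson (offset i) F (q, u (toT q)).
Hypotheses (C0 : 0 < C) (CK0 : 0 < CK).
Hypotheses
  (bF : forall i q p, sqnorm p <= 1 -> `|partial_p i F (q, p)| <= C)
  (brF : forall i q p, sqnorm p <= 1 -> `|poisson (offset i) F (q, p)| <= C)
  (bwF : forall i q p, sqnorm p <= 1 -> `|poisson (poisson (offset i) F) F (q, p)| <= C)
  (bw : forall i k q p, sqnorm p <= 1 -> `|partial_p k (poisson (offset i) F) (q, p)| <= C)
  (bK : forall i q p, sqnorm p <= 1 -> `|partial_p i K (q, p)| <= CK)
  (brK : forall i q p, sqnorm p <= 1 -> `|poisson (offset i) K (q, p)| <= CK).
(* the brackets of the offsets with F vary by at most d / 4 across the tube
   (small1) and by at most d / 4 during the kick (small2); the kick moves an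
   offset by four tube widths (small3), the overlap by at most one (small4);
   the angles move little during the kick (small5) and the overlap (small6) *)
Hypotheses (small1 : n%:R * delta * C <= d / 4) (small2 : c' * C * tau <= d / 4)
  (small3 : 8 * delta <= c * d * tau) (small4 : c' * (C + CK) * sigma <= delta)
  (small5 : 2 * pi * (c' * C * tau) <= 4^-1)
  (small6 : 2 * pi * (c' * (C + CK) * sigma) <= 4^-1).

Let sK : fsmooth K := fsmooth_tube su delta.
Let pK : qperiodic K := @qperiodic_tube R n u delta.

Variable x : R -> phase.
Hypothesis solx : ham_solution (two_stage F K a b) x.
Hypothesis x10 : x 1 = x 0.

Let evo P (sP : fsmooth P) (pP : qperiodic P) t t01 :=
  @evolution R n F K a b sF sK pF pK x solx P t sP pP t01.

Let evo_mean P : fsmooth P -> qperiodic P -> forall r s, 0 <= r -> r <= s -> s <= 1 ->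
  exists2 t, r <= t <= s & on_phase P (x s) - on_phase P (x r) =
    (a t * poisson P F (lift_pt (x t)) + b t * poisson P K (lift_pt (x t))) * (s - r).
Proof.
move=> sP pP r s r0 rs s1.
have [t t_rs E] := deriv01_mean r0 rs s1 (fun t t01 => evo sP pP t01).
by exists t => //; move: t_rs; rewrite in_itv.
Qed.

Let x_in t : 0 <= t -> t <= 1 -> sqnorm (x t).2 <= 1.
Proof.
move=> t0 t1; have t01 : t \in `[0, 1] by rewrite in_itv/= t0.
have [+ _] := solx t01.
by rewrite /unitCotangent /= enorm_lt1 => /ltW.
Qed.

Let c'0 : 0 <= c'.
Proof. by have /andP[h1 h2] := a_bd 0; exact: le_trans h1 h2. Qed.

Let absD (r1 r2 : R) t :
  `|a t * r1 + b t * r2| <= c' * (`|r1| + `|r2|).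
Proof.
have /andP[a1 a2] := a_bd t; have /andP[b1 b2] := b_bd t.
apply: le_trans (ler_normD _ _) _; rewrite !normrM (ger0_norm a1) (ger0_norm b1) mulrDr.
by apply: lerD; rewrite ler_wpM2r.
Qed.

Let absD1 (r1 r2 : R) t : t <= tau -> `|a t * r1 + b t * r2| <= c' * `|r1|.
Proof.
move=> /b_0 ->; rewrite mul0r addr0; have /andP[a1 a2] := a_bd t.
by rewrite normrM (ger0_norm a1) ler_wpM2r.
Qed.

(** After time tau + sigma the Hamiltonian is a function of time times K. *)
Lemma tube_conserved t : tau + sigma <= t -> t <= 1 -> on_phase K (x t) = on_phase K (x 1).
Proof.
move=> ht t1; have [|s /andP[st s1]] := evo_mean sK pK _ t1 (lexx 1).
  by rewrite (le_trans _ ht)// addr_ge0 ?ltW.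
rewrite poissonxx mulr0 addr0 a_0; last exact: le_trans ht st.
by rewrite !mul0r => /eqP; rewrite subr_eq0 => /eqP ->.
Qed.

(** The cosine of the angular displacement starts from 1, loses at most 1/4 during
the kick and at most 1/4 during the overlap, and is then constant, because K is
minimal, hence stationary, along the solution. *)
Lemma loop_stays_close t i : on_phase K (x 1) = 0 -> 0 <= t -> t <= 1 ->
  0 < on_phase (cosdist (repr (x 0).1) i) (x t).
Proof.
move=> K1; set q0 := repr (x 0).1; set P := cosdist q0 i.
have pi0 : 0 < (pi : R) by exact: pi_gt0.
have sP : fsmooth P := fsmooth_cosdist q0 i.
have pP : qperiodic P := @qperiodic_cosdist R n q0 i.
have P0 : on_phase P (x 0) = 1 by rewrite /on_phase /P /cosdist /lift_pt /= subrr /cosT mulr0 cos0.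
have step1 s : 0 <= s -> s <= tau -> 1 - 4^-1 <= on_phase P (x s).
  move=> s0 st; have s1 : s <= 1 by rewrite (le_trans st)// (le_trans _ ts1)// lerDl ltW.
  have [r /andP[r0 rs] E] := evo_mean sP pP (lexx 0) s0 s1.
  have rt := le_trans rs st; have r1 := le_trans rs s1.
  have h := absD1 (poisson P F (lift_pt (x r))) (poisson P K (lift_pt (x r))) rt.
  have h2 : `|poisson P F (lift_pt (x r))| <= 2 * pi * C.
    by apply: poisson_cosdist_le; apply: bF; exact: x_in.
  rewrite P0 subr0 in E; set w := (a _ * _ + b _ * _) in E h.
  have h3 : `|w| <= c' * (2 * pi * C) by rewrite (le_trans h)// ler_wpM2l.
  have h4 : `|w * s| <= c' * (2 * pi * C) * tau.
    by rewrite normrM (ger0_norm s0); apply: ler_pM.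
  move: h4; rewrite -E ler_norml => /andP[h4 _]; move: small5 h4; nra.
have ht0 : 0 <= tau by exact: ltW.
have step2 s : tau <= s -> s <= tau + sigma -> 2^-1 <= on_phase P (x s).
  move=> ts st; have s1 : s <= 1 by rewrite (le_trans st).
  have [r /andP[r0 rs] E] := evo_mean sP pP ht0 ts s1.
  have r00 := le_trans ht0 r0; have r1 := le_trans rs s1.
  have h := absD (poisson P F (lift_pt (x r))) (poisson P K (lift_pt (x r))) r.
  have h2 : `|poisson P F (lift_pt (x r))| <= 2 * pi * C.
    by apply: poisson_cosdist_le; apply: bF; exact: x_in.
  have h2' : `|poisson P K (lift_pt (x r))| <= 2 * pi * CK.
    by apply: poisson_cosdist_le; apply: bK; exact: x_in.
  set w := (a _ * _ + b _ * _) in E h.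
  have h3 : `|w| <= c' * (2 * pi * (C + CK)).
    by rewrite (le_trans h)// ler_wpM2l// mulrDr lerD.
  have h4 : `|w * (s - tau)| <= c' * (2 * pi * (C + CK)) * sigma.
    rewrite normrM (@ger0_norm _ (s - tau)) ?subr_ge0//; apply: ler_pM => //.
      by rewrite subr_ge0.
    by rewrite lerBlDl.
  have := step1 tau ht0 (lexx _).
  move: h4; rewrite -E ler_norml => /andP[h4 _]; move: small6 h4; nra.
move=> t0 t1; have [tt|tt] := leP t tau.
  by have := step1 t t0 tt; lra.
have [ts|ts] := leP t (tau + sigma).
  by have := step2 t (ltW tt) ts; lra.
have ts0 : 0 <= tau + sigma by rewrite addr_ge0 ?ltW.
have [r /andP[r0 rs]] := evo_mean sP pP ts0 (ltW ts) t1.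
rewrite (a_0 r0) mul0r add0r poisson_cosdist.
have -> : partial_p i K (lift_pt (x r)) = 0.
  apply: tube_deriv_out => //; rewrite -/(on_phase K (x r)) tube_conserved//.
  exact: le_trans rs t1.
rewrite !mulr0 mul0r => /eqP; rewrite subr_eq0 => /eqP ->.
have tts : tau <= tau + sigma by rewrite lerDl ltW.
by have := step2 _ tts (lexx _); lra.
Qed.

Lemma offset_lt z i : fibre_dist2 z < delta ^+ 2 -> `|offset i z| < delta.
Proof.
move=> h; rewrite -(@ltr_sqr _ `|_|) ?nnegrE ?(ltW del0)// real_normK ?num_real//.
apply: le_lt_trans h; rewrite /fibre_dist2 (bigD1 i)//= lerDl.
by apply: sumr_ge0 => j _; exact: sqr_ge0.
Qed.

(** Mean value theorem along the segment that joins (q, p) to the section within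
the fibre. *)
Lemma bracket_near_section i q p : fibre_dist2 (q, p) < delta ^+ 2 ->
  poisson (offset i) F (q, u (toT q)) - d / 4 <= poisson (offset i) F (q, p).
Proof.
move=> h; set W := poisson (offset i) F.
have sW : fsmooth W by apply: fsmooth_poisson => //; exact: fsmooth_offset.
pose r := p - u (toT q); pose z0 : chart := (q, u (toT q)).
have [s s1] := @MVT_from0 _ (fun s : R => W (s *: ((0, r) : chart) + z0))
   (fun s => 'D_((0, r) : chart) W (s *: ((0, r) : chart) + z0)) 1
   (fun s => is_derive_line (diff_derivable (fsmooth_diff _ sW))).
rewrite scale0r add0r scale1r mul1r.
have -> : ((0, r) : chart) + z0 = (q, p).
  by apply: injective_projections; rewrite /= ?add0r// /r subrK.
rewrite derive_pair; last exact: fsmooth_diff.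
set zs := _ + z0; set S := \sum_(_ < _) _ => E.
have zsE : zs = (q, s *: r + u (toT q)).
  by apply: injective_projections => //=; rewrite scaler0 add0r.
have zs1 : sqnorm (s *: r + u (toT q)) <= 1.
  apply: (@near1 q); rewrite fibre_dist2E addrK sqnormZ; apply: le_lt_trans h.
  rewrite fibre_dist2E -/r ler_piMl ?sqnorm_ge0//.
  by rewrite -real_normK ?num_real// expr_le1// (le_trans s1)// normr1.
have S1 : `|S| <= d / 4.
  apply: le_trans small1; apply: le_trans (ler_norm_sum _ _ _) _.
  apply: (@le_trans _ _ (\sum_(k < n) delta * C)); last first.
    by rewrite sumr_const card_ord -mulrA mulr_natl.
  apply: ler_sum => k _; rewrite mxE mul0r add0r normrM zsE.
  apply: ler_pM => //; last exact: bw.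
  have := @offset_lt (q, p) k h; rewrite /offset /r !mxE => /ltW.
  exact: le_trans.
by move: S1; rewrite -E ler_norml => /andP[+ _]; rewrite -/z0; lra.
Qed.

(** Otherwise the solution is in the tube at times 0 and tau + sigma.  But the
offset r_i chosen by transversality grows at rate at least c d / 2 up to time
tau, since its bracket with F can lose only d / 4 to the initial distance to
the section and d / 4 to the motion; the overlap changes r_i by at most delta.
So r_i would end beyond - delta + 4 delta - delta = 2 delta. *)
Lemma closed_orbit_off_tube : on_phase K (x 1) = 0.
Proof.
apply/eqP/negP => /negP; rewrite /on_phase tube_neq0// => h1.
have ts0 : 0 <= tau + sigma by rewrite addr_ge0 ?ltW.
have h2 : fibre_dist2 (lift_pt (x (tau + sigma))) < delta ^+ 2.
  rewrite -tube_neq0// -/(on_phase K _) tube_conserved//.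
  by rewrite /on_phase tube_neq0.
have h0 : fibre_dist2 (lift_pt (x 0)) < delta ^+ 2 by rewrite -x10.
have [i di] := transF (repr (x 0).1); set r := offset i.
have sr : fsmooth r by exact: fsmooth_offset.
have pr : qperiodic r by exact: qperiodic_offset.
pose W := poisson r F.
have sW : fsmooth W by exact: fsmooth_poisson.
have pW : qperiodic W by exact: qperiodic_poisson.
(* W is the speed at which the offset in direction i grows under F *)
have W0 : d - d / 4 <= on_phase W (x 0).
  apply: le_trans (bracket_near_section i h0).
  by rewrite lerD2r.
have tau1 : tau <= 1 by rewrite (le_trans _ ts1)// lerDl ltW.
have Wt t : 0 <= t -> t <= tau -> d / 2 <= on_phase W (x t).
  move=> t0 tt; have t1 := le_trans tt tau1.
  have [s /andP[s0 st] E] := evo_mean sW pW (lexx 0) t0 t1.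
  have h := absD1 (poisson W F (lift_pt (x s))) (poisson W K (lift_pt (x s))) (le_trans st tt).
  set w := (a _ * _ + b _ * _) in E h.
  have h3 : `|w| <= c' * C.
    rewrite (le_trans h)// ler_wpM2l//; apply: bwF; apply: x_in => //.
    exact: le_trans st t1.
  have h4 : `|w * (t - 0)| <= c' * C * tau.
    by rewrite subr0 normrM (ger0_norm t0); apply: ler_pM.
  move: h4; rewrite -E ler_norml => /andP[h4 _]; move: small2 h4 W0; lra.
have r0 : - delta < on_phase r (x 0).
  by have := offset_lt i h0; rewrite ltr_norml => /andP[].
have r1 : on_phase r (x 0) + c * (d / 2) * tau <= on_phase r (x tau).
  have [s /andP[s0 st] E] := evo_mean sr pr (lexx 0) (ltW tau0) tau1.
  rewrite -lerBrDl E subr0 ler_wpM2r ?(ltW tau0)// (b_0 st) mul0r addr0.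
  have d20 : 0 <= d / 2.
    have h : 0 <= c' * C * tau.
      by rewrite mulr_ge0 ?(ltW tau0)// mulr_ge0// ltW.
    by move: small2 h; lra.
  apply: ler_pM => //; [exact: ltW|exact: a_ge|exact: Wt].
have r2 : on_phase r (x tau) - delta <= on_phase r (x (tau + sigma)).
  have tts : tau <= tau + sigma by rewrite lerDl ltW.
  have [s /andP[s0 st] E] := evo_mean sr pr (ltW tau0) tts ts1.
  have s00 := le_trans (ltW tau0) s0; have s1 := le_trans st ts1.
  have h := absD (poisson r F (lift_pt (x s))) (poisson r K (lift_pt (x s))) s.
  set w := (a _ * _ + b _ * _) in E h.
  have h3 : `|w| <= c' * (C + CK).
    rewrite (le_trans h)// ler_wpM2l// lerD//.
      by apply: brF; exact: x_in.
    by apply: brK; exact: x_in.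
  have h4 : `|w * (tau + sigma - tau)| <= delta.
    rewrite addrAC subrr add0r normrM (@ger0_norm _ sigma) ?(ltW sig0)//.
    by rewrite (le_trans _ small4)// ler_wpM2r// ltW.
  by move: h4; rewrite -E ler_norml => /andP[h4 _]; move: h4; lra.
have r3 : on_phase r (x (tau + sigma)) < delta.
  by have := offset_lt i h2; rewrite ltr_norml => /andP[].
move: small3 r0 r1 r2 r3 del0; lra.
Qed.

Lemma closed_orbit_contractible : contractible_loop (@unitCotangent R n) x.
Proof.
apply: contractible_small => //.
- by move=> P sP pP; apply: deriv01_continuous (fun t t01 => evo sP pP t01).
- by move=> t /solx[].
- move=> t i; rewrite in_itv/= => /andP[t0 t1].
  by apply: loop_stays_close => //; exact: closed_orbit_off_tube.
Qed.

End Dynamics.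

(** * Two-stage Hamiltonians *)

Section Switch.
Variable R : realType.

(** Equal to 0 after time tau + sigma, at least c before time tau + sigma / 2, and
bounded by c e^2 independently of sigma. *)
Definition switch_off (c tau sigma t : R) : R :=
  c * expR 1 * ubump ((tau + sigma - t) / sigma).
Definition switch_on (c tau sigma t : R) : R :=
  c * expR 1 * ubump ((t - tau) / sigma).

Variables (c tau sigma : R).
Hypotheses (c0 : 0 < c) (sig0 : 0 < sigma).

Let ce0 : 0 <= c * expR 1.
Proof. by rewrite mulr_ge0 ?expR_ge0// ltW. Qed.

Lemma ubump_scaled_bd s : 0 <= c * expR 1 * ubump s <= c * expR 1 * expR 1.
Proof.
by apply/andP; split; [rewrite mulr_ge0 ?ubump_ge0|rewrite ler_wpM2l ?ubump_le].
Qed.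

Lemma ubump_scaled_ge s : 2^-1 <= s -> c <= c * expR 1 * ubump s.
Proof.
move=> /ubump_half h; rewrite -[X in X <= _]mulr1 -mulrA ler_pM2l//.
by apply: le_trans (ler_wpM2l (expR_ge0 1) h); rewrite expRxMexpNx_1.
Qed.

Lemma ubump_scaled_0 s : s <= 0 -> c * expR 1 * ubump s = 0.
Proof.
move=> s0; apply/eqP; rewrite mulf_eq0; apply/orP; right.
by apply/negPn; rewrite ubump_neq0 -leNgt.
Qed.

(** The arguments of the two bumps add up to 1, so one of them is at least 1/2. *)
Lemma switch_sum t : c <= switch_off c tau sigma t + switch_on c tau sigma t.
Proof.
have [b1 _] := andP (ubump_scaled_bd ((tau + sigma - t) / sigma)).
have [b2 _] := andP (ubump_scaled_bd ((t - tau) / sigma)).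
have E : (tau + sigma - t) / sigma + (t - tau) / sigma = 1.
  by field; rewrite gt_eqF.
rewrite /switch_off /switch_on.
have [h|h] := leP 2^-1 ((tau + sigma - t) / sigma).
  by have := ubump_scaled_ge h; lra.
have h2 : 2^-1 <= (t - tau) / sigma by lra.
by have := ubump_scaled_ge h2; lra.
Qed.

Lemma fsmooth_affine (k l : R) : fsmooth (fun t : R => k * t + l).
Proof.
apply: fsmoothD; last exact: fsmooth_cst.
exact: (@fsmooth_linear _ _ ( *:%R k)) (@scaler_continuous _ _ _).
Qed.

Lemma fsmooth_switch_off : fsmooth (switch_off c tau sigma).
Proof.
rewrite (_ : switch_off c tau sigma = cst (c * expR 1) *
   (@ubump R \o (fun t => (- sigma^-1) * t + (tau + sigma) / sigma))).
  exact: fsmoothM (@fsmooth_cst _ _ _) (fsmooth_comp (@fsmooth_ubump R) (fsmooth_affine _ _)).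
apply/funext => t; rewrite /switch_off !fctE/=; congr (_ * ubump _).
by field; rewrite gt_eqF.
Qed.

Lemma fsmooth_switch_on : fsmooth (switch_on c tau sigma).
Proof.
rewrite (_ : switch_on c tau sigma = cst (c * expR 1) *
   (@ubump R \o (fun t => sigma^-1 * t + (- tau / sigma)))).
  exact: fsmoothM (@fsmooth_cst _ _ _) (fsmooth_comp (@fsmooth_ubump R) (fsmooth_affine _ _)).
apply/funext => t; rewrite /switch_on !fctE/=; congr (_ * ubump _).
by field; rewrite gt_eqF.
Qed.

End Switch.

Section Hamiltonians.
Variables (R : realType) (n : nat).
Local Notation chart := ('rV[R]_n * 'rV[R]_n)%type.
Local Notation phase := (torus R n * 'rV[R]_n)%type.

(** The support is a closed subset of the product of [0, 1], the torus and the
closed ball of squared radius rho, which is compact and lies over the open unit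
ball. *)
Lemma two_stage_hamiltonian (F K : chart -> R) (a b : R -> R) (rho : R) :
  fsmooth F -> fsmooth K -> qperiodic F -> qperiodic K -> fsmooth a -> fsmooth b -> rho < 1 ->
  (forall z, F z != 0 -> sqnorm z.2 <= rho) ->
  (forall z, K z != 0 -> sqnorm z.2 <= rho) ->
  hamiltonian (two_stage F K a b).
Proof.
move=> sF sK pF pK sa sb rho1 F0 K0.
pose B : set 'rV[R]_n := [set p | sqnorm p <= rho].
have cB : closed B.
  apply: (@preimage_closed _ _ (@sqnorm R n) [set y | y <= rho]); last exact: closed_le.
  by move=> p _; exact: sqnorm_continuous.
have B1 p : B p -> enorm p < 1 by rewrite enorm_lt1 => /le_lt_trans; apply.
have KB : compact B.
  apply: (@subclosed_compact _ _ (box (-1) 1)) => //; first exact: box_compact.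
  move=> p /B1; rewrite enorm_lt1 => p1 i /=.
  rewrite in_itv/= -ler_norml -(@ler_sqr _ `|_|) ?nnegrE// expr1n real_normK ?num_real//.
  exact: le_trans (coord_sqnorm _ _) (ltW p1).
pose A : set (R * phase) := `[0, 1]%classic `*` ([set: torus R n] `*` B).
have KA : compact A.
  apply: compact_setX; first exact: segment_compact.
  exact: compact_setX (@torus_compact R n) KB.
have cA : closed A.
  have -> : A = fst @^-1` `[0, 1]%classic `&` (fun z : R * phase => z.2.2) @^-1` B.
    by apply/seteqP; split => -[t [y p]] /=; rewrite /A /=; tauto.
  apply: closedI; apply: preimage_closed => //.
  - by move=> z _; exact: cvg_fst.
  - exact: interval_closed.
  - move=> z _; apply: (@continuous_comp _ _ _ snd snd); exact: cvg_snd.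
have supA : ham_supp (two_stage F K a b) `<=` A.
  rewrite [X in _ `<=` X]((closure_id A).1 cA); apply: closure_subset => -[t [y p]] /= [[/= t01 _]].
  rewrite /two_stage => h; split => //; split => //=.
  have : (F (lift_pt (y, p)) != 0) || (K (lift_pt (y, p)) != 0).
    rewrite -negb_and; apply: contra h => /andP[/eqP h1 /eqP h2].
    by rewrite /on_phase h1 h2 !mulr0 addr0.
  by case/orP => [/F0|/K0].
split.
- move=> z _; exists (ham_lift (two_stage F K a b)); last exact: filterE.
  have -> : ham_lift (two_stage F K a b) =
      (fun z : R * chart => a z.1) * (fun z : R * chart => F z.2) +
      (fun z : R * chart => b z.1) * (fun z : R * chart => K z.2).
    apply/funext => -[t [q p]]; rewrite /ham_lift /two_stage !fctE/=.
    by rewrite !on_phase_toT.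
  apply: fsmooth_smooth.
  have s1 (f : R -> R) : fsmooth f -> fsmooth (fun z : R * chart => f z.1).
    move=> sf; apply: (@fsmooth_pullback _ _ _ fst f) => // y; exact: cvg_fst.
  have s2 (f : chart -> R) : fsmooth f -> fsmooth (fun z : R * chart => f z.2).
    move=> sf; apply: (@fsmooth_pullback _ _ _ snd f) => // y; exact: cvg_snd.
  by apply: fsmoothD; apply: fsmoothM; [exact: s1|exact: s2|exact: s1|exact: s2].
- by apply: subclosed_compact KA supA; exact: closed_closure.
- by move=> z /supA [z1 [_ z2]]; split => //; exact: B1.
Qed.

End Hamiltonians.

(** * The theorem *)

Lemma small_enough (R : realType) (X1 X2 X3 y1 y2 y3 : R) :
  0 <= X1 -> 0 <= X2 -> 0 <= X3 -> 0 < y1 -> 0 < y2 -> 0 < y3 ->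
  exists2 t, 0 < t & [/\ X1 * t <= y1, X2 * t <= y2 & X3 * t <= y3].
Proof.
move=> X10 X20 X30 y10 y20 y30.
have h (X y t : R) : 0 <= X -> 0 < y -> 0 < t -> t <= y / (X + 1) -> X * t <= y.
  by move=> X0 y0 t0; rewrite ler_pdivlMr ?ltr_wpDl//; nra.
have p (X y : R) : 0 <= X -> 0 < y -> 0 < y / (X + 1).
  by move=> X0 y0; rewrite divr_gt0 ?ltr_wpDl.
pose t := Num.min (y1 / (X1 + 1)) (Num.min (y2 / (X2 + 1)) (y3 / (X3 + 1))).
have t0 : 0 < t by rewrite !lt_min !p.
have : t <= t by []. rewrite {2}/t !le_min => /and3P[t1 t2 t3].
by exists t => //; split; apply: h.
Qed.

Theorem theoremC (R : realType) (n : nat) :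
  exists (k : nat) (eps : R), 0 < eps /\
  forall u : torus R n -> 'rV[R]_n,
    smooth_torus u -> Csmall k eps u ->
    (forall q, unitCotangent (q, u q)) ->
    ~ closed_form u ->
  forall c : R, 0 < c ->
  exists H : R -> torus R n * 'rV[R]_n -> R,
    [/\ hamiltonian H,
        forall (t : R) x, t \in `[0, 1] -> graph_section u x -> c <= H t x &
        forall x : R -> torus R n * 'rV[R]_n,
          ham_solution H x -> x 1 = x 0 ->
          contractible_loop (@unitCotangent R n) x].
Proof.
exists 0%N, 1; split=> // u su _ uM ncl c c0.
have pi0 : 0 < (pi : R) by exact: pi_gt0.
have half0 : 0 < (2^-1 : R) by rewrite invr_gt0.
have quarter0 : 0 < (4^-1 : R) by rewrite invr_gt0.
have e0 := expR_gt0 (1 : R).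
have [j [i [a tw]]] : exists j i a, twist u j i a != 0.
  apply: contrapT => h; apply: ncl => i j q; apply/eqP; rewrite -subr_eq0.
  by apply/negPn/negP => e; apply: h; exists j, i, q.
have [lam [N [L [d d0 trans]]]] := kick_transversality su tw.
have [D D0 [rho rho1 Drho]] := section_tube su uM.
have ph : qperiodic (fun z : 'rV[R]_n * 'rV[R]_n => height a lam L z.1).
  by move=> q q' p e; exact: height_toT.
have d40 : 0 < d / 4 by rewrite divr_gt0.
(* B bounds the height, so that adding 1 + B keeps the kick above 1 *)
have [B hB] := qperiodic_bounded (fsmooth_continuous (fsmooth_fst (fsmooth_height a lam L))) ph.
pose F := kick u j i a lam N L D (1 + B).
have sF : fsmooth F by exact: fsmooth_kick.
have pF : qperiodic F by exact: qperiodic_kick.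
pose W k := poisson (offset u k) F.
have sW k : fsmooth (W k) by apply: fsmooth_poisson => //; exact: fsmooth_offset.
have pW k : qperiodic (W k) by apply: qperiodic_poisson => //; exact: qperiodic_offset.
have [C1 C10 h1] := qperiodic_bounded_family
  (fun k => fsmooth_derive (0, delta_mx 0 k) sF)
  (fun k => qperiodic_derive (0, delta_mx 0 k) pF).
have [C2 C20 h2] := qperiodic_bounded_family sW pW.
have [C3 C30 h3] := qperiodic_bounded_family
  (fun k => fsmooth_poisson (sW k) sF) (fun k => qperiodic_poisson (pW k) pF).
have [C4 C40 h4] := @qperiodic_bounded_family _ _ ('I_n * 'I_n)%type
  (fun kl => partial_p kl.2 (W kl.1))
  (fun kl => fsmooth_derive (0, delta_mx 0 kl.2) (sW kl.1))
  (fun kl => qperiodic_derive (0, delta_mx 0 kl.2) (pW kl.1)).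
pose C := C1 + C2 + C3 + C4.
have C0 : 0 < C by rewrite !addr_gt0.
have [C1C C2C C3C C4C] : [/\ C1 <= C, C2 <= C, C3 <= C & C4 <= C].
  by rewrite /C; split; move: C10 C20 C30 C40; clear; lra.
pose c' := c * expR 1 * expR 1.
have c'0 : 0 < c' by rewrite !mulr_gt0.
(* the duration of the first stage depends on F alone *)
have [tau tau0 [t1 t2 t3]] := @small_enough R 1 (c' * C) (2 * pi * (c' * C))
  2^-1 (d / 4) 4^-1 ler01 (mulr_ge0 (ltW c'0) (ltW C0))
  (mulr_ge0 (mulr_ge0 (ler0n _ _) (ltW pi0)) (mulr_ge0 (ltW c'0) (ltW C0)))
  half0 d40 quarter0.
(* the tube is thin with respect to the displacement c d tau / 2 *)
have cdtau0 : 0 < c * d * tau by rewrite !mulr_gt0.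
have [delta del0 [d1 d2 d3]] := @small_enough R 1 (n%:R * C) 8
  D (d / 4) (c * d * tau) ler01 (mulr_ge0 (ler0n _ _) (ltW C0)) (ler0n _ _)
  D0 d40 cdtau0.
pose K := tube u delta.
have sK : fsmooth K by exact: fsmooth_tube.
have pK : qperiodic K by exact: qperiodic_tube.
have [C5 C50 h5] := qperiodic_bounded_family
  (fun k => fsmooth_derive (0, delta_mx 0 k) sK)
  (fun k => qperiodic_derive (0, delta_mx 0 k) pK).
have [C6 C60 h6] := qperiodic_bounded_family
  (fun k => fsmooth_poisson (fsmooth_offset su k) sK)
  (fun k => qperiodic_poisson (qperiodic_offset u k) pK).
pose CK := C5 + C6.
have CK0 : 0 < CK by rewrite addr_gt0.
have [C5C C6C] : C5 <= CK /\ C6 <= CK by rewrite /CK lerDl lerDr !ltW.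
(* the overlap is short with respect to the size of the derivatives of K *)
have CCK0 : 0 <= c' * (C + CK) by rewrite mulr_ge0 ?addr_ge0 ?ltW.
have [sigma sig0 [s1 s2 s3]] := @small_enough R 1 (c' * (C + CK))
  (2 * pi * (c' * (C + CK))) 2^-1 delta 4^-1 ler01 CCK0
  (mulr_ge0 (mulr_ge0 (ler0n _ _) (ltW pi0)) CCK0)
  half0 del0 quarter0.
have coreE (q : 'rV[R]_n) : fibre_dist2 u (q, u (toT q)) = 0.
  by rewrite fibre_dist2E subrr /sqnorm big1// => k _; rewrite mxE expr0n.
have nearD z : fibre_dist2 u z < delta ^+ 2 -> fibre_dist2 u z < D ^+ 2.
  move=> /lt_le_trans; apply; rewrite mul1r in d1.
  by rewrite lerXn2r ?nnegrE// ltW.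
exists (two_stage F K (switch_off c tau sigma) (switch_on c tau sigma)); split.
- apply: (@two_stage_hamiltonian _ _ _ _ _ _ rho) => //.
  + exact: fsmooth_switch_off.
  + exact: fsmooth_switch_on.
  + move=> [q p] Fz; apply: (Drho q); rewrite -tube_neq0//.
    by apply: contra_neq Fz => t0; rewrite /F /kick !fctE t0 mul0r.
  + by move=> [q p]; rewrite tube_neq0// => /nearD/Drho.
- move=> t x _ [xM xS].
  have zE : lift_pt x = (repr x.1, u (toT (repr x.1))) by rewrite toT_repr /lift_pt xS.
  have z0 : fibre_dist2 u (lift_pt x) = 0 by rewrite zE coreE.
  have K1 : on_phase K x = 1 by exact: tube_core.
  have F1 : 1 <= on_phase F x.
    rewrite /on_phase /F /kick /ramp !fctE tube_core// mul1r (fibre_dist2_offset _ z0) mulr0 addr0.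
    have x1 : sqnorm x.2 <= 1 by move: xM; rewrite /unitCotangent/= enorm_lt1 => /ltW.
    have := hB (lift_pt x).1 x.2 x1; rewrite /= ler_norml => /andP[+ _]; lra.
  rewrite /two_stage K1 mulr1; apply: le_trans (switch_sum tau c0 sig0 t) _.
  by rewrite lerD2r ler_peMr//; case/andP: (ubump_scaled_bd c0 ((tau + sigma - t) / sigma)).
- move=> x solx x10.
  have q1 : (2 : R)^-1 + 2^-1 = 1 by rewrite [RHS](splitr 1) mul1r.
  apply: (@closed_orbit_contractible R n u su F
    (switch_off c tau sigma) (switch_on c tau sigma) delta c c' tau sigma d C CK
    sF pF) => //.
  + by rewrite -q1; apply: lerD; rewrite -[leLHS]mul1r.
  + move=> t tt; rewrite /switch_off; apply: ubump_scaled_ge => //; rewrite ler_pdivlMr//.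
    by move: sig0 tt; lra.
  + by move=> t; exact: ubump_scaled_bd.
  + move=> t tt; rewrite /switch_off /switch_on; apply: ubump_scaled_0.
    by rewrite pmulr_lle0 ?invr_gt0// subr_le0.
  + by move=> t; exact: ubump_scaled_bd.
  + move=> t tt; rewrite /switch_off /switch_on; apply: ubump_scaled_0.
    by rewrite pmulr_lle0 ?invr_gt0// subr_le0.
  + by move=> q p /nearD/Drho/le_trans; apply; exact: ltW.
  + move=> q; have [k hk] := trans q; exists k.
    by rewrite (poisson_kick su _ _ _ _ _ _ _ _ _ (coreE q)) -mulNr; move: hk; rewrite mulNr.
  + by move=> k q p p1; exact: le_trans (h1 k q p p1) C1C.
  + by move=> k q p p1; exact: le_trans (h2 k q p p1) C2C.
  + by move=> k q p p1; exact: le_trans (h3 k q p p1) C3C.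
  + by move=> k l q p p1; exact: le_trans (h4 (k, l) q p p1) C4C.
  + by move=> k q p p1; exact: le_trans (h5 k q p p1) C5C.
  + by move=> k q p p1; exact: le_trans (h6 k q p p1) C6C.
  + by rewrite mulrAC.
  + by rewrite mulrA.
  + by rewrite mulrA.
Qed.
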